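(* In the $q$-Racah setting described in the context, let $N\le s\le M-1$. Let $v$ be any nonzero vector in $\operatorname{Ker}(T_s)=\operatorname{Im}\big(\operatorname{Res}_{z=q^{-s+1}}A_s(z)\big)$, let $v_2$ be a vector with $T_sv_2=v$, and put $$\hat v=R_s(q^{-s-1})A_s(q^{-s})v,$$ $$\hat v_2=\frac{R_s(q^{-s-1})A_s(q^{-s})}{q^{-s-1}-u^2q^s}\left(q^{-s}\left.\frac{d\left(A_s^{-1}(z)R_s^{-1}(q^{-1}z)\right)}{dz}\right|_{z=q^{-s}}\hat v+(q^{-s}-u^2q^{s-1})v_2\right).$$ Then the gap probabilities satisfy the recursion $$\frac{D_{s+2}D_s}{D_{s+1}^2}=\frac{\omega(s+1)}{\omega(s)}\left(\frac{\Phi^-(q^{-s})}{\Phi^+(q^{-s})}\right)^2\frac{\det[\hat v,\hat v_2]}{\det[v,v_2]} .$$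
   Context: Parameters: $q\in(0,1)$, integers $1\le N\le M$, reals $\alpha,\beta>0$, $\delta\ge0$, $\gamma=q^{-M-1}$, with $\beta\delta<1$, $\beta\ge\gamma$, $\alpha\ge\gamma$ and $\gamma\delta q\in(0,1)$. Let $u>0$, $u^2=\gamma\delta q^2$, $\sigma(z)=z+\frac{u^2}{qz}$, $\pi_x=\sigma(q^{-x})$ for $x=0,\dots,M$ (an increasing sequence). The $q$-Racah weight is $$\omega(x)=\frac{(\alpha q,\beta\delta q,\gamma q,\gamma\delta q;q)_x}{(q,\alpha^{-1}\gamma\delta q,\beta^{-1}\gamma q,\delta q;q)_x}\,\frac{1-\gamma\delta q^{2x+1}}{(\alpha\beta q)^x(1-\gamma\delta q)},\qquad x=0,\dots,M,$$ where $(y_1,\dots,y_i;q)_k=\prod_j(y_j;q)_k$, $(y;q)_k=(1-y)(1-yq)\cdots(1-yq^{k-1})$. The $q$-Racah ensemble is the probability measure on $\{0\le\lambda_1<\dots<\lambda_N\le M\}$ proportional to $\prod_{i<j}(\pi_{\lambda_i}-\pi_{\lambda_j})^2\prod_i\omega(\lambda_i)$, and $D_s=\mathrm{Prob}(\lambda_N<s)$ (so $D_{M+1}=1$). For $N\le s\le M+1$, $m_s(z)$ is the unique $2\times2$ matrix function, analytic on $\mathbb{C}\setminus\{\pi_0,\dots,\pi_{s-1}\}$ with simple poles at $\pi_0,\dots,\pi_{s-1}$, such that $\operatorname{Res}_{z=\pi_x}m_s(z)=\lim_{z\to\pi_x}m_s(z)\begin{bmatrix}0&\omega(x)\\0&0\end{bmatrix}$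 for $0\le x\le s-1$ and $m_s(z)\begin{bmatrix}z^{-N}&0\\0&z^N\end{bmatrix}=I+O(z^{-1})$ as $z\to\infty$. For $N\le s\le M$, $T_s$ is the constant nilpotent matrix with $m_{s+1}(z)=\left(I+\frac{T_s}{z-\pi_s}\right)m_s(z)$. Standing assumption: writing $T_s=\begin{bmatrix}t_s^{11}&t_s^{12}\\t_s^{21}&-t_s^{11}\end{bmatrix}$, one has $t_s^{11}\ne0$ (hence $t_s^{12},t_s^{21}\neq0$) for all $N\le s\le M$. Put $$R_s(z)=I+\frac{T_s}{\sigma(z)-\sigma(q^{-s})},$$ $$\Phi^+(z)=(z-\alpha q)(z-\beta\delta q)(z-\gamma q)(z-\gamma\delta q),\qquad \Phi^-(z)=\alpha\beta(z-\alpha^{-1}\gamma\delta q)(z-\beta^{-1}\gamma q)(z-\delta q)(z-q),$$ $$A_s(z)=m_s(\sigma(q^{-1}z))\begin{bmatrix}\Phi^+(z)/\Phi^-(z)&0\\0&1\end{bmatrix}m_s^{-1}(\sigma(z)),$$ so that $A_{s+1}(z)=R_s(q^{-1}z)A_s(z)R_s^{-1}(z)$. $[a,b]$ denotes the matrix with columns $a,b$. (Changing $v_2$ by a multiple of $v$ does not affect the determinants.) *)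

(* Defs.v *)
From HB Require Import structures.
From mathcomp Require Import all_boot all_order all_algebra.
From mathcomp Require Import complex.
From mathcomp Require Import all_classical all_reals all_analysis.

Set Implicit Arguments.
Unset Strict Implicit.
Unset Printing Implicit Defensive.

Import Order.TTheory GRing.Theory Num.Theory numFieldNormedType.Exports.
Local Open Scope classical_set_scope.
Local Open Scope complex_scope.
Local Open Scope ring_scope.

(* R[i] packed as a numClosedFieldType: the topology and the norm of
   MathComp-Analysis are inferred on abstract numFieldTypes, not on the bare
   type R[i]. *)
Definition Cx (R : realType) : numClosedFieldType := R[i].

Definition toC (R : realType) (x : R) : Cx R := x%:C.

(* The parameters q, alpha, beta, gamma, delta, u, N, M; the constraints that
   they satisfy are hypotheses of the theorem. *)
Record qRacah_param (R : realType) := QRacahParam {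
  rq : R; ralpha : R; rbeta : R; rgamma : R; rdelta : R; ru : R;
  rN : nat; rM : nat }.

Definition qpoch (F : fieldType) (q y : F) (k : nat) : F :=
  \prod_(i < k) (1 - y * q ^+ i).

Definition sigma (F : fieldType) (q u z : F) : F := z + u ^+ 2 / (q * z).

Section Ensemble.
Context {R : realType} (p : qRacah_param R).
Local Notation q := (rq p).
Local Notation a := (ralpha p).
Local Notation b := (rbeta p).
Local Notation c := (rgamma p).
Local Notation d := (rdelta p).

Definition node (x : nat) : R := sigma q (ru p) (q ^- x).

Definition omega (x : nat) : R :=
  (qpoch q (a * q) x * qpoch q (b * d * q) x
     * qpoch q (c * q) x * qpoch q (c * d * q) x)
  / (qpoch q q x * qpoch q (a^-1 * c * d * q) x
     * qpoch q (b^-1 * c * q) x * qpoch q (d * q) x)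
  * ((1 - c * d * q ^+ x.*2.+1) / ((a * b * q) ^+ x * (1 - c * d * q))).

(* lambda_1 < ... < lambda_N in {0, ..., M} *)
Definition is_config (l : (rN p).-tuple 'I_(rM p).+1) : bool :=
  sorted ltn [seq val i | i <- l].

Definition config_weight (l : (rN p).-tuple 'I_(rM p).+1) : R :=
  (\prod_(i < rN p) \prod_(j < rN p | (i < j)%N)
      (node (tnth l i) - node (tnth l j)) ^+ 2)
  * \prod_(i < rN p) omega (tnth l i).

Definition qRacah_prob (E : pred ((rN p).-tuple 'I_(rM p).+1)) : R :=
  (\sum_(l | is_config l && E l) config_weight l)
  / \sum_(l | is_config l) config_weight l.

(* The last entry of l is lambda_N, as N >= 1. *)
Definition gap_prob (s : nat) : R :=
  qRacah_prob [pred l : (rN p).-tuple _ |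
                (last 0 [seq val i | i <- tval l] < s)%N].

End Ensemble.

Section Matrices.
Context {R : realType}.
Local Notation C := (Cx R).

Definition mx2 (x11 x12 x21 x22 : C) : 'M[C]_2 :=
  \matrix_(i, j) if i == 0 then (if j == 0 then x11 else x12)
                 else (if j == 0 then x21 else x22).

Definition analytic_at (f : C -> C) (z0 : C) : Prop :=
  exists a : nat -> C,
    \forall z \near z0, series (fun k => a k * (z - z0) ^+ k) @ \oo --> f z.

Definition mx_analytic_at (F : C -> 'M[C]_2) (z0 : C) : Prop :=
  forall i j, analytic_at (fun z => F z i j) z0.

(* F has a simple pole at z0, with residue r: the principal part of the Laurent
   expansion of F at z0 is r / (z - z0). *)
Definition simple_pole (F : C -> 'M[C]_2) (z0 : C) (r : 'M[C]_2) : Prop :=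
  r != 0 /\
  exists2 G : C -> 'M[C]_2, mx_analytic_at G z0 &
    \forall z \near z0^', F z = (z - z0)^-1 *: r + G z.

End Matrices.

Section RiemannHilbert.
Context {R : realType} (p : qRacah_param R).
Local Notation C := (Cx R).
Local Notation q := (toC (rq p)).
Local Notation a := (toC (ralpha p)).
Local Notation b := (toC (rbeta p)).
Local Notation c := (toC (rgamma p)).
Local Notation d := (toC (rdelta p)).
Local Notation sig := (sigma q (toC (ru p))).

Definition poles (s : nat) : seq C := [seq toC (node p x) | x <- iota 0 s].

(* The discrete Riemann-Hilbert problem for m_s. Only the values of m off the
   poles matter: its values at the poles themselves are arbitrary. *)
Definition solves_DRHP (s : nat) (m : C -> 'M[C]_2) : Prop :=
  [/\ forall z, z \notin poles s -> mx_analytic_at m z,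
      forall x, (x < s)%N ->
        exists2 r, simple_pole m (toC (node p x)) r &
          m z *m mx2 0 (toC (omega p x)) 0 0
            @[z --> (toC (node p x))^'] --> r &
      exists K B : R, forall z : C, toC B <= `|z| -> forall i j,
        `|(m z *m mx2 (z ^- rN p) 0 0 (z ^+ rN p) - 1) i j|
          <= toC K / `|z| ].

Definition Phi_plus (z : C) : C :=
  (z - a * q) * (z - b * d * q) * (z - c * q) * (z - c * d * q).

Definition Phi_minus (z : C) : C :=
  a * b * (z - a^-1 * c * d * q) * (z - b^-1 * c * q) * (z - d * q) * (z - q).

(* m_s, T_s |-> A_s, R_s *)
Definition Amx (ms : C -> 'M[C]_2) (z : C) : 'M[C]_2 :=
  ms (sig (q^-1 * z)) *m mx2 (Phi_plus z / Phi_minus z) 0 0 1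
    *m invmx (ms (sig z)).

Definition Rmx (s : nat) (Ts : 'M[C]_2) (z : C) : 'M[C]_2 :=
  1 + (sig z - sig (q ^- s))^-1 *: Ts.

Section Vectors.
Variables (s : nat) (ms : C -> 'M[C]_2) (Ts : 'M[C]_2).
Local Notation RA := (Rmx s Ts (q ^- s.+1) *m Amx ms (q ^- s)).

Definition v_hat (v : 'cV[C]_2) : 'cV[C]_2 := RA *m v.

(* 'D_1 F z is the complex derivative F'(z); s >= 1 in q ^+ s.-1. *)
Definition v2_hat (v v2 : 'cV[C]_2) : 'cV[C]_2 :=
  (q ^- s.+1 - toC (ru p) ^+ 2 * q ^+ s)^-1 *: (RA *m
    (q ^- s *: ('D_1 (fun z : C =>
                  invmx (Amx ms z) *m invmx (Rmx s Ts (q^-1 * z))) (q ^- s)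
                *m v_hat v)
     + (q ^- s - toC (ru p) ^+ 2 * q ^+ s.-1) *: v2)).

End Vectors.
End RiemannHilbert.

Definition det2 (R : realType) (x y : 'cV[Cx R]_2) : Cx R :=
  \det (row_mx x y : 'M[Cx R]_2).

(* Main.v *)
(* The first column of m_s consists of the orthogonal polynomials P (monic, of
   degree N) and Q (of degree < N) for the weight omega on pi_0, ..., pi_(s-1),
   and the second column of their Cauchy transforms. This follows from
   Liouville's theorem, which for functions given by local power series comes
   from the maximum principle: among the maximizers of |f| one of maximal real
   part cannot have f constant around it.
   By Andreief's identity D_s is proportional to the Hankel determinant H_s of
   the first s weights, and the Christoffel-Darboux kernel turns the rank-one
   update H_s -> H_(s+1) into D_(s+1) = D_s (1 - omega(s) kappa_s), where
   kappa_s = P Q' - Q P' at pi_s. The residue condition at pi_s shows that T_s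
   maps the second column of m_s(pi_s) to tau_s times the first column p_s,
   with tau_s (1 - omega(s) kappa_s) = omega(s). Finally v = k p_s,
   v_hat = k phi p_(s+1) with phi = Phi^+ / Phi^- at q^-s, and
   det [v_hat, v2_hat] is expressed by kappa_s, kappa_(s+1) and tau_s, which
   combine through the first-order recursion of the q-Racah weight. *)
Require Import Defs.
From HB Require Import structures.
From mathcomp Require Import all_boot all_order all_algebra perm.
From mathcomp Require Import complex.
From mathcomp Require Import all_classical all_reals all_analysis.
From mathcomp Require Import ring lra.

Set Implicit Arguments.
Unset Strict Implicit.
Unset Printing Implicit Defensive.

Import Order.TTheory GRing.Theory Num.Theory numFieldNormedType.Exports.
Local Open Scope classical_set_scope.
Local Open Scope complex_scope.
Local Open Scope ring_scope.

(** * Power series and Liouville's theorem *)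

(** The values of [m_s] at its poles are arbitrary, so identities across a pole are proved on a
    punctured neighbourhood and extended by continuity. Once the entries of [m_s] are known, the
    functions met near [q^-s] are rational there, and residues and derivatives come from exact
    division by [z - q^-s]. Nonvanishing is read off the Riemann-Hilbert problem itself: a simple
    pole has a nonzero residue, which forces omega(x) != 0 for x <= M and, by the convention x / 0 =
    0, keeps the zeros of [Phi_plus] and [Phi_minus] away from the points in play. The slopes q^-x
    sigma'(q^-x) enter because A_s is a function of [z] while m_s is one of sigma(z). Both hatted
    vectors are images under the same matrix R_s A_s, of determinant phi; its determinant factors
    out, and in the determinant that remains, formed with the derivative of the inverse product, the
    Wronskian P C(Q) - Q C(P) = 1 eliminates the Cauchy transforms. *)

Section PowerSeries.
Context {C : numClosedFieldType}.
Implicit Types (a : nat -> C) (f g : C -> C) (z w r B : C).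

(** The body of [analytic_at] with its coefficients exposed. *)
Definition has_pseries a z0 f :=
  \forall z \near z0, series (fun k => a k * (z - z0) ^+ k) @ \oo --> f z.

Lemma cvgC_unique {T : Type} (F : set_system T) {FF : ProperFilter F}
    (h : T -> C) (l l' : C) : h @ F --> l -> h @ F --> l' -> l = l'.
Proof. exact: norm_cvg_unique. Qed.

Lemma has_pseries0 a z0 f : has_pseries a z0 f -> f z0 = a 0%N.
Proof.
move=> /nbhs_singleton; rewrite subrr => h.
apply: (cvgC_unique h).
apply: cvg_near_cst; near=> n.
have n0 : (0 < n)%N by near: n; exists 1%N.
rewrite /series /= -(prednK n0) big_nat_recl //= expr0 mulr1 big1 ?addr0 // => i _.
by rewrite exprS mul0r mulr0.
Unshelve. all: by end_near. Qed.

(** Convergence at the single point [z0 + w] makes the terms there tend to 0, hence stay bounded.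
    All later estimates on coefficients start from this bound. *)
Lemma has_pseries_bounded a z0 f : has_pseries a z0 f ->
  exists r B, [/\ 0 < r, 0 < B, forall k, `|a k| * r ^+ k <= B &
    forall z, `|z - z0| < r ->
      series (fun k => a k * (z - z0) ^+ k) @ \oo --> f z].
Proof.
move=> /nbhs_ballP[e /= e0 he].
pose w := e / 2.
have w0 : 0 < w by rewrite divr_gt0.
have we : w < e by rewrite ltr_pdivrMr // ltr_pMr // ltr1n.
have hw : ball z0 e (z0 + w).
  by rewrite -ball_normE /= opprD addrA subrr add0r normrN gtr0_norm.
have hs : series (fun k => a k * (z0 + w - z0) ^+ k) @ \oo --> f (z0 + w).
  exact: he hw.
have h0 := cvg_series_cvg_0 (cvgP _ hs).
have [M [Mr hM]] := cvg_seq_bounded (cvgP _ h0).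
exists w, (`|M| + 1); split => //.
- move=> k; have M1 : M < `|M| + 1 by rewrite ltr_pwDr ?real_ler_norm.
  have := hM _ M1 k I.
  rewrite /=.
  by rewrite addrAC subrr add0r normrM normrX (gtr0_norm w0).
- move=> z zw; apply: he; rewrite -ball_normE /= distrC.
  exact: lt_trans we.
Qed.

(** Dividing by [z - z0] shifts the coefficients; the value at the centre is patched with [a 1],
    where the quotient would be 0 / 0. *)
Lemma has_pseries_shift a z0 f : has_pseries a z0 f ->
  has_pseries (fun k => a k.+1) z0
    (fun z => if z == z0 then a 1%N else (f z - f z0) / (z - z0)).
Proof.
move=> h; have f0 := has_pseries0 h; rewrite f0.
apply: filterS h => z; case: eqP => [-> _|/eqP zz0 h].
  apply: cvg_near_cst; near=> n.
  have n0 : (0 < n)%N by near: n; exists 1%N.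
  rewrite /series /= -(prednK n0) big_nat_recl //= subrr expr0 mulr1.
  by rewrite big1 ?addr0 // => i _; rewrite exprS mul0r mulr0.
have nz : z - z0 != 0 by rewrite subr_eq0.
have -> : series (fun k => a k.+1 * (z - z0) ^+ k) =
   (fun n => (series (fun k => a k * (z - z0) ^+ k) n.+1 - a 0%N) / (z - z0)).
  apply/funext => n; rewrite /series /= big_nat_recl //= expr0 mulr1.
  rewrite addrAC subrr add0r mulr_suml; apply: eq_bigr => i _.
  by rewrite exprS [X in _ = X]mulrC mulrCA mulKf.
apply: cvgMl; apply: cvgB; last exact: cvg_cst.
by rewrite (cvg_shiftS (series _)).
Unshelve. all: by end_near. Qed.

(** Iterating the shift yields an exact Taylor remainder that again has a power series, so no
    remainder estimate is involved. *)
Lemma has_pseries_taylor a z0 f k : has_pseries a z0 f ->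
  exists2 g, has_pseries (fun j => a (k + j)%N) z0 g &
    forall z, f z = \sum_(j < k) a j * (z - z0) ^+ j + (z - z0) ^+ k * g z.
Proof.
move=> h; elim: k => [|k [g hg fg]].
  by exists f => // z; rewrite big_ord0 add0r expr0 mul1r.
exists (fun z => if z == z0 then a k.+1 else (g z - g z0) / (z - z0)).
  have := has_pseries_shift hg; rewrite addn1.
  by under [X in has_pseries X]funext => j do rewrite addnS -addSn.
move=> z; rewrite fg big_ord_recr /= -addrA; congr (_ + _).
have g0 := has_pseries0 hg; rewrite addn0 in g0; rewrite -g0.
case: eqP => [->|/eqP zz0].
  by rewrite subrr exprS !mul0r addr0 mulrC.
have nz : z - z0 != 0 by rewrite subr_eq0.
rewrite exprS (mulrC (z - z0)) -mulrA (mulrC (z - z0)) divfK // (mulrC (g z0)).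
by rewrite -mulrDr subrKC.
Qed.

(** On half the radius the terms are dominated by [B / 2^k], whose sum is at most [2 B]. *)
Lemma has_pseries_locally_bounded a z0 f : has_pseries a z0 f ->
  exists2 B, 0 < B & \forall z \near z0, `|f z| <= B.
Proof.
move=> /has_pseries_bounded[r [B [r0 B0 hB h]]].
exists (B * 2); first by rewrite mulr_gt0.
apply/nbhs_ballP; exists (r / 2); first by rewrite /= divr_gt0.
move=> z; rewrite -ball_normE /= distrC => zr.
have {}h := h z (lt_trans zr _).
have {h} := h _; rewrite ltr_pdivrMr // ltr_pMr // ltr1n => /(_ isT) h.
have hn n : `|series (fun k => a k * (z - z0) ^+ k) n| <= B * 2.
  have hk k : `|a k * (z - z0) ^+ k| <= B * 2^-1 ^+ k.
    rewrite normrM normrX (le_trans (y := `|a k| * (r / 2) ^+ k)) //.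
      by rewrite ler_wpM2l // lerXn2r ?nnegrE // ?ltW // divr_gt0.
    by rewrite exprMn mulrA ler_wpM2r // exprn_ge0 // invr_ge0.
  rewrite (le_trans (ler_norm_sum _ _ _)) //.
  rewrite (le_trans (ler_sum _ (fun k _ => hk k))) // -mulr_sumr ler_pM2l //.
  have -> : \sum_(0 <= i < n) (2^-1 : C) ^+ i = 2 - 2 * 2^-1 ^+ n.
    elim: n => [|n IH]; first by rewrite big_nil expr0 mulr1 subrr.
    by rewrite big_nat_recr //= IH exprS; field.
  by rewrite gerBl mulr_ge0 // exprn_ge0 // invr_ge0.
(* The bound passes to the limit: a positive excess [|f z| - 2 B] would be at most half of
   itself. *)
apply: contrapT => hneg.
have : \forall n \near \oo, `|f z| - B * 2 <= `|f z - series (fun k => a k * (z - z0) ^+ k) n|.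
  apply: nearW => n; rewrite lerBlDr -lerBlDl.
  have := lerB_dist (f z) (f z - series (fun k => a k * (z - z0) ^+ k) n).
  by rewrite opprB addrCA subrr addr0 => /le_trans; apply; exact: hn.
move=> hb; have : 0 < `|f z| - B * 2.
  have B2 : 0 <= B * 2 by rewrite mulr_ge0 // ltW.
  by rewrite subr_gt0 real_ltNge ?ger0_real //; apply/negP.
move=> p0; have p2 : 0 < (`|f z| - B * 2) / 2 by rewrite divr_gt0.
move/cvgrPdist_le : h => /(_ _ p2) h.
have [n [h1 h2]] := filter_ex (filterI hb h).
have := le_trans h1 h2; rewrite ler_pdivlMr // ger_pMr // => /le_trans.
by move=> /(_ 1 (lexx _)); rewrite lern1.
Qed.

Lemma has_pseries_continuous a z0 f : has_pseries a z0 f ->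
  f @ z0 --> f z0.
Proof.
move=> h; have [g hg fg] := has_pseries_taylor 1 h.
have [B B0 hB] := has_pseries_locally_bounded hg.
apply/(@cvgrPdist_le _ _ _ (nbhs z0)) => e e0.
have he : \forall z \near z0, `|z - z0| <= e / B.
  apply/nbhs_ballP; exists (e / B); first by rewrite /= divr_gt0.
  by move=> y; rewrite -ball_normE /= distrC => /ltW.
apply: filterS2 hB he => z h1 h2.
rewrite (has_pseries0 h) (fg z) big_ord1 expr0 mulr1 expr1 opprD addrA subrr sub0r.
by rewrite normrN normrM (le_trans (ler_pM _ _ h2 h1)) // divfK ?gt_eqF.
Qed.

(* If not locally constant, f = a_0 + w^k (g_0 + w h) with g_0 != 0; in the
   direction w^k = t^k a_0 / g_0 the first correction increases |f|. *)
Lemma has_pseries_max_principle a z0 f : has_pseries a z0 f ->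
  (\forall z \near z0, `|f z| <= `|f z0|) -> \forall z \near z0, f z = f z0.
Proof.
move=> h hmax.
have [f00|f0] := eqVneq (f z0) 0.
  by apply: filterS hmax => z; rewrite f00 normr0 normr_le0 => /eqP.
have [hex|hn] := pselect (exists k, a k.+1 != 0); last first.
  have [g hg fg] := has_pseries_taylor 1 h.
  apply: filterS hg => z hg; rewrite fg big_ord1 expr0 mulr1 -(has_pseries0 h).
  suff -> : g z = 0 by rewrite mulr0 addr0.
  apply: (cvgC_unique hg); apply: cvg_near_cst; apply: nearW => n.
  rewrite /series /= big1 // => j _; rewrite add1n.
  by have [->|aj] := eqVneq (a j.+1) 0; [rewrite mul0r|case: hn; exists j].
have [k ak kmin] := ex_minnP hex; set g0 := a k.+1 in ak.
have [g hg fg] := has_pseries_taylor k.+1 h.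
have [h1 hh1 gh1] := has_pseries_taylor 1 hg.
have [B B0 hB] := has_pseries_locally_bounded hh1.
have fE z : f z = f z0 + (z - z0) ^+ k.+1 * (g0 + (z - z0) * h1 z).
  rewrite {1}fg gh1 big_ord1 expr0 mulr1 addn0 expr1 big_ord_recl expr0 mulr1.
  rewrite -(has_pseries0 h) big1 ?addr0 // => j _; rewrite lift0.
  have [->|/kmin] := eqVneq (a j.+1) 0; first by rewrite mul0r.
  by rewrite leqNgt ltn_ord.
exfalso; have hI : nbhs z0 (fun z => `|f z| <= `|f z0| /\ `|h1 z| <= B).
  exact: filterI hmax hB.
move/nbhs_ballP : hI => [e /= e0 he].
pose ze := k.+1.-root (f z0 / g0).
(* [t = 1 / S] keeps the point in the ball of radius [e] and makes the second correction smaller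
   than [g0]; the sum serves both bounds at once. *)
pose S := `|ze| / e + `|ze| * B / `|g0| + 1.
have ze0 : 0 <= `|ze| by [].
have g0p : 0 < `|g0| by rewrite normr_gt0.
have S0 : 0 < S.
  by rewrite ltr_wpDl // addr_ge0 // ?divr_ge0 ?mulr_ge0 // ltW.
pose t := S^-1; have t0 : 0 < t by rewrite invr_gt0.
have te : t * `|ze| < e.
  rewrite mulrC ltr_pdivrMr // /S mulrDr mulr1 mulrDr mulrCA mulfV ?gt_eqF //.
  rewrite mulr1 -addrA ltrDl ltr_wpDl // ?mulr_ge0 ?divr_ge0 ?mulr_ge0 //; exact: ltW.
have tB : t * `|ze| * B < `|g0|.
  rewrite -mulrA mulrC ltr_pdivrMr // /S mulrDr mulr1 mulrDr.
  rewrite [X in _ + X + _]mulrCA mulfV ?gt_eqF // mulr1 addrAC ltrDr.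
  by rewrite ltr_wpDl // mulr_ge0 // ?divr_ge0 // ltW.
have [] := he (z0 + t * ze).
  by rewrite -ball_normE /= opprD addrA subrr sub0r normrN normrM gtr0_norm.
rewrite fE addrAC subrr add0r; set H := h1 _ => hle HB.
have rootE : ze ^+ k.+1 = f z0 / g0 by rewrite rootCK.
have eps1 : `|t * ze * H / g0| < 1.
  rewrite normrM normfV ltr_pdivrMr // mul1r !normrM (gtr0_norm t0).
  by rewrite (le_lt_trans _ tB) // ler_wpM2l // mulr_ge0 // ltW.
have tk : 0 < t ^+ k.+1 by rewrite exprn_gt0.
have E : f z0 + (t * ze) ^+ k.+1 * (g0 + t * ze * H) =
    f z0 * ((1 + t ^+ k.+1) + t ^+ k.+1 * (t * ze * H / g0)).
  by rewrite exprMn rootE; field.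
move: hle; rewrite E normrM ger_pMr ?normr_gt0 // => hle.
have := lerB_dist (1 + t ^+ k.+1) (- (t ^+ k.+1 * (t * ze * H / g0))).
rewrite opprK => /le_trans/(_ hle); rewrite normrN normrM (gtr0_norm tk).
rewrite (gtr0_norm (addr_gt0 ltr01 tk)).
by rewrite lerBlDr lerD2l ler_pMr // => /(lt_le_trans eps1); rewrite ltxx.
Qed.

End PowerSeries.

(** * Operations on power series *)

Section MorePowerSeries.
Context {C : numClosedFieldType}.
Implicit Types (a b : nat -> C) (f g : C -> C) (z w r B c : C).

Lemma has_pseries_near a z0 f g : (\forall z \near z0, f z = g z) ->
  has_pseries a z0 f -> has_pseries a z0 g.
Proof. by apply: filterS2 => z <-. Qed.

Lemma has_pseriesB a b z0 f g : has_pseries a z0 f -> has_pseries b z0 g ->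
  has_pseries (fun k => a k - b k) z0 (fun z => f z - g z).
Proof.
apply: filterS2 => z hf hg.
have -> : series (fun k => (a k - b k) * (z - z0) ^+ k) =
    (fun n => series (fun k => a k * (z - z0) ^+ k) n -
              series (fun k => b k * (z - z0) ^+ k) n).
  apply/funext => n; rewrite /series /= -sumrB.
  by apply: eq_bigr => k _; rewrite mulrBl.
exact: cvgB hf hg.
Qed.

Lemma has_pseriesZ a z0 f c : has_pseries a z0 f ->
  has_pseries (fun k => c * a k) z0 (fun z => c * f z).
Proof.
apply: filterS => z hf.
have -> : series (fun k => c * a k * (z - z0) ^+ k) =
    (fun n => c * series (fun k => a k * (z - z0) ^+ k) n).
  apply/funext => n; rewrite /series /= mulr_sumr.
  by apply: eq_bigr => k _; rewrite mulrA.
by apply: cvgMr.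
Qed.

Lemma has_pseries_cst z0 c :
  has_pseries (fun k => if k is 0%N then c else 0) z0 (fun=> c).
Proof.
apply: (@filterE _ (nbhs z0)) => z; apply: cvg_near_cst; near=> n.
have n0 : (0 < n)%N by near: n; exists 1%N.
rewrite /series /= -(prednK n0) big_nat_recl //= expr0 mulr1.
by rewrite big1 ?addr0 // => i _; rewrite mul0r.
Unshelve. all: by end_near. Qed.

(** An abstract closed field may be non-archimedean, so the convergence of geometric sequences is a
    parameter here; [cvg_exp_half] supplies it over [R[i]]. *)
Hypothesis half : forall w, `|w| <= 2^-1 -> (fun n => w ^+ n) @ \oo --> (0 : C).

(** The coefficients of the quotient solve the first-order recursion obtained by multiplying back by
    [z - c]. Within half the distance from [z0] to [c] the recursion preserves a bound of the form
    [|b k| rho^k <= const]. *)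
Lemma has_pseries_divX a z0 f c : has_pseries a z0 f -> c != z0 ->
  exists b, has_pseries b z0 (fun z => f z / (z - c)).
Proof.
move=> /has_pseries_bounded[r [B [r0 B0 hB h]]] cz0.
pose e := c - z0; have e0 : e != 0 by rewrite subr_eq0.
pose b := fix b k := if k is k'.+1 then (b k' - a k'.+1) / e else - a 0%N / e.
exists b.
have ep : 0 < `|e| by rewrite normr_gt0.
(* This choice lies below both [r] and [|e| / 2]. *)
pose rho := (r^-1 + 2 / `|e|)^-1.
have rV0 : 0 < r^-1 by rewrite invr_gt0.
have e20 : 0 < 2 / `|e| by rewrite divr_gt0.
have rho0 : 0 < rho by rewrite invr_gt0 addr_gt0.
have rhor : rho <= r.
  by rewrite -[leRHS]invrK lef_pV2 ?posrE ?addr_gt0 // lerDl ltW.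
have rhoe : rho <= `|e| / 2.
  rewrite -[leRHS]invrK lef_pV2 ?posrE ?addr_gt0 ?invr_gt0 ?divr_gt0 //.
  by rewrite invf_div lerDr ltW.
have ha k : `|a k| * rho ^+ k <= B.
  rewrite (le_trans _ (hB k)) // ler_wpM2l // lerXn2r // nnegrE ltW //.
have hb k : `|b k| * rho ^+ k <= B * 2 / `|e|.
  elim: k => [|k IH].
    rewrite expr0 mulr1 /= normrM normrN normfV ler_pM2r ?invr_gt0 //.
    have := ha 0%N; rewrite expr0 mulr1 => /le_trans; apply.
    by rewrite ler_pMr // ler1n.
  rewrite /= normrM normfV mulrAC ler_pM2r ?invr_gt0 //.
  rewrite (le_trans (y := (`|b k| + `|a k.+1|) * rho ^+ k.+1)) //.
    by rewrite ler_pM2r ?exprn_gt0 // ler_normB.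
  rewrite mulrDl mulrDr mulr1 lerD // exprSr mulrA.
  rewrite (le_trans (ler_pM _ _ IH rhoe)) ?mulr_ge0 ?exprn_ge0 ?(ltW rho0) //.
  by rewrite mulrA divfK ?gt_eqF // mulfK // pnatr_eq0.
have B'0 : 0 < B * 2 / `|e| by rewrite divr_gt0 // mulr_gt0.
apply/nbhs_ballP; exists (rho / 2) => /=; first by rewrite divr_gt0.
move=> z; rewrite -ball_normE /= distrC => hz.
have rho2 : rho / 2 < rho by rewrite ltr_pdivrMr // ltr_pMr // ltr1n.
have {}h := h z (lt_le_trans (lt_trans hz rho2) rhor).
have zc : z - c = (z - z0) - e by rewrite opprB addrA subrK.
have zc0 : z - c != 0.
  rewrite zc subr_eq0; apply: contraTneq (lt_trans hz rho2) => ->.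
  by rewrite le_gtF // (le_trans rhoe) // ler_pdivrMr // ler_peMr // ?ler1n.
set w := z - z0 in h hz zc.
(* The product telescopes up to one boundary term, which [lim0] sends to 0. *)
have recE n : (w - e) * series (fun k => b k * w ^+ k) n.+1 =
    series (fun k => a k * w ^+ k) n.+1 + b n * w ^+ n.+1.
  elim: n => [|n IH].
    rewrite /series /= !big_nat1 expr0 !mulr1 expr1 /=.
    by field.
  rewrite seriesSr mulrDr {}IH [in RHS]seriesSr -addrA -[RHS]addrA; congr (_ + _).
  have bS : b n.+1 = (b n - a n.+1) / e by [].
  by rewrite bS !exprS; move: (b n) => bn; field.
have lim0 : (fun n => b n * w ^+ n.+1) @ \oo --> (0 : C).
  have wr : `|w / rho| <= 2^-1.
    by rewrite normrM normfV (gtr0_norm rho0) ler_pdivrMr // mulrC ltW.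
  have hw := half wr; apply/cvgrPdist_le => d d0.
  pose d' := d / (B * 2 / `|e| * (`|w| + 1)).
  have w1 : 0 < `|w| + 1 by rewrite ltr_wpDl.
  have d'0 : 0 < d' by rewrite divr_gt0 // mulr_gt0.
  move/cvgrPdist_le : hw => /(_ d' d'0); apply: filterS => n.
  rewrite !sub0r !normrN => hn.
  have -> : b n * w ^+ n.+1 = (b n * rho ^+ n) * (w / rho) ^+ n * w.
    have : rho ^+ n != 0 by rewrite expf_neq0 // gt_eqF.
    rewrite expr_div_n exprSr; move: (rho ^+ n) (w ^+ n) => x y x0.
    by field.
  rewrite !normrM (ger0_norm (exprn_ge0 _ (ltW rho0))).
  have : `|b n| * rho ^+ n * `|(w / rho) ^+ n| <= B * 2 / `|e| * d'.
    by rewrite ler_pM // mulr_ge0 // exprn_ge0 // ltW.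
  have wle : `|w| <= `|w| + 1 by rewrite lerDl.
  have b0 : 0 <= `|b n| * rho ^+ n * `|(w / rho) ^+ n|.
    by rewrite !mulr_ge0 // exprn_ge0 // ltW.
  move=> /(ler_pM b0 (normr_ge0 w))/(_ wle)/le_trans; apply.
  rewrite /d' le_eqVlt; apply/orP; left; apply/eqP.
  by field; rewrite !gt_eqF.
have shiftE u : (series u @ \oo --> f z / (z - c)) =
    ((fun n => series u n.+1) @ \oo --> f z / (z - c)).
  by rewrite (cvg_shiftS (series u)).
rewrite shiftE.
have -> : (fun n => series (fun k => b k * w ^+ k) n.+1) = (fun n =>
   (series (fun k => a k * w ^+ k) n.+1 + b n * w ^+ n.+1) / (z - c)).
  by apply/funext => n; rewrite -recE -zc mulrAC divff // mul1r.
apply: cvgMl; rewrite -[f z]addr0; apply: cvgD lim0.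
by rewrite (cvg_shiftS (series _)).
Qed.

End MorePowerSeries.

(** * Real numbers inside the complex field *)

Section RealInComplex.
Context {R : realType}.
Local Notation C := (Cx R).

Lemma lt0_toC (e : C) : 0 < e -> exists2 x : R, 0 < x & e = toC x.
Proof.
case: e => x y; rewrite ltcE /= => /andP[/eqP -> x0].
by exists x.
Qed.

Lemma toC_le (x y : R) : (toC x <= toC y) = (x <= y).
Proof. by rewrite /toC lecR. Qed.

Lemma toC_lt (x y : R) : (toC x < toC y) = (x < y).
Proof. by rewrite /toC ltcR. Qed.

Lemma cvg_exp_half (w : C) : `|w| <= 2^-1 -> (fun n => w ^+ n) @ \oo --> (0 : C).
Proof.
move=> w2; apply/cvgrPdist_le => e /lt0_toC[x x0 ->].
have h : (fun n => (2^-1 : R) ^+ n) @ \oo --> (0 : R).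
  by apply: cvg_expr; rewrite ger0_norm ?invr_ge0 // invf_lt1 // ltr1n.
move/cvgrPdist_le : h => /(_ x x0); apply: filterS => n.
rewrite !sub0r !normrN !normrX => hx.
rewrite (le_trans (lerXn2r _ _ _ w2)) ?nnegrE ?invr_ge0 //.
move: hx; rewrite ger0_norm ?invr_ge0 // -toC_le; congr (_ <= _).
by rewrite /toC rmorphXn /= fmorphV /= rmorph_nat.
Qed.

End RealInComplex.

HB.instance Definition _ (R : realType) :=
  GRing.RMorphism.copy (@toC R) (real_complex R).

(** * Liouville's theorem and meromorphic functions with finitely many poles *)

Section Liouville.
Context {R : realType}.
Local Notation C := (Cx R).
Implicit Types (f g : C -> C) (z : C).

Lemma norm_toC (x : R) : `|toC x| = toC `|x|.
Proof. by rewrite normc_def /= expr0n /= addr0 sqrtr_sqr. Qed.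

Lemma normr_toC_Re (z : C) : `|z| = toC (complex.Re `|z|).
Proof. by rewrite normc_def. Qed.

Lemma normc_ge_Im (z : C) : toC `|complex.Im z| <= `|z|.
Proof.
case: z => x y; rewrite normc_def /= toC_le -sqrtr_sqr ler_wsqrtr //.
by rewrite lerDr sqr_ge0.
Qed.

(** The plane as [R * R], where products of segments are compact. *)
Definition cplx (xy : R * R) : C := xy.1 +i* xy.2.

Lemma norm_cplx_le (x y : R) : `|cplx (x, y)| <= toC (`|x| + `|y|).
Proof.
have -> : cplx (x, y) = toC x + 'i%C * toC y by rewrite [LHS]complexE.
rewrite (le_trans (ler_normD _ _)) // normrM !norm_toC.
have -> : `|'i%C : C| = 1 by rewrite normc_def /= expr0n expr1n /= add0r sqrtr1.
by rewrite mul1r rmorphD.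
Qed.

Lemma cplx_continuous f (xy : R * R) : f @ cplx xy --> f (cplx xy) ->
  (fun t => complex.Re `|f (cplx t)|) @ xy --> complex.Re `|f (cplx xy)|.
Proof.
move=> fc; apply/(@cvgrPdist_le _ _ _ (nbhs xy)) => e e0.
move/(@cvgrPdist_le _ _ _ (nbhs (cplx xy)))  : fc => /(_ (toC e)).
rewrite -[0]/(toC 0) toC_lt => /(_ e0) /nbhs_ballP[d /= /lt0_toC[r r0 ->] hr].
apply/nbhs_ballP; exists (r / 2) => /=; first by rewrite divr_gt0.
case=> x y [] /=; case: xy hr => x0 y0 hr; rewrite -!ball_normE /= => hx hy.
have : `|f (cplx (x0, y0)) - f (cplx (x, y))| <= toC e.
  apply: hr; rewrite -ball_normE /=.
  have -> : cplx (x0, y0) - cplx (x, y) = cplx (x0 - x, y0 - y) by [].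
  rewrite (le_lt_trans (norm_cplx_le _ _)) // toC_lt (splitr r) ltrD //.
move=> h; rewrite -toC_le -norm_toC rmorphB /= -!normr_toC_Re.
exact: le_trans (ler_dist_dist _ _) h.
Qed.

(** Decay at infinity confines the points where [|f|] reaches [|f z1| > 0] to a square, so a global
    maximum exists and the maximum principle applies to it. *)
Lemma bounded_entire_eq0 f (K B : R) :
  (forall z, analytic_at f z) ->
  (forall z, toC B <= `|z| -> `|f z| * `|z| <= toC K) -> forall z, f z = 0.
Proof.
move=> fan fK z1; apply/eqP/negP => /negP f1.
pose F (t : R * R) := complex.Re `|f (cplx t)|.
have fcont z : f @ z --> f z by have [a ha] := fan z; exact: has_pseries_continuous ha.
have Fcont : continuous F by move=> t; apply: cplx_continuous.
(* Beyond radius [M] the decay bound holds and gives [|f z| < |f z1|], while [z1] itself lies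
   inside. *)
pose M := `|B| + `|K| / complex.Re `|f z1| + complex.Re `|z1| + 1.
pose A : set (R * R) := `[- M, M]%classic `*` `[- M, M]%classic.
have f1p : 0 < complex.Re `|f z1| by rewrite -toC_lt -normr_toC_Re normr_gt0.
have z1p : 0 <= complex.Re `|z1|.
  by rewrite -toC_le -normr_toC_Re; exact: normr_ge0.
have KM : 0 <= `|K| / complex.Re `|f z1| by rewrite divr_ge0 // ltW.
have B0 : 0 <= `|B| by [].
have cA : compact A by apply: compact_setX; exact: segment_compact.
have Mout z : toC M < `|z| -> `|f z| < `|f z1|.
  move=> Mz; have Bz : toC B <= `|z|.
    rewrite (le_trans _ (ltW Mz)) // toC_le /M (le_trans (ler_norm _)) //; lra.
  have z0 : 0 < `|z| by rewrite (lt_trans _ Mz) // -[0]/(toC 0) toC_lt /M; lra.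
  have := fK _ Bz; rewrite -ler_pdivlMr // => /le_lt_trans; apply.
  rewrite ltr_pdivrMr // mulrC -ltr_pdivrMr ?normr_gt0 //.
  rewrite (le_lt_trans _ Mz) // [`|f z1|]normr_toC_Re -fmorph_div /= toC_le.
  have : K / complex.Re `|f z1| <= `|K| / complex.Re `|f z1|.
    by rewrite ler_pM2r ?invr_gt0 // ler_norm.
  rewrite /M; lra.
have inA z : `|z| <= toC M -> A (complex.Re z, complex.Im z).
  move=> zM; rewrite /A /= !in_itv /= -!ler_norml -!toC_le.
  split; apply: le_trans zM; first exact: normc_ge_Re.
  exact: normc_ge_Im.
have cplxE z : cplx (complex.Re z, complex.Im z) = z by case: z.
have z1M : `|z1| <= toC M by rewrite normr_toC_Re toC_le /M; lra.
have outin z : `|f z1| <= `|f z| -> `|z| <= toC M.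
  move=> h; rewrite normr_toC_Re toC_le leNgt; apply/negP => hM.
  have := Mout z; rewrite [`|z|]normr_toC_Re toC_lt => /(_ hM).
  by move=> /lt_le_trans/(_ h); rewrite ltxx.
have F_le z z' : (`|f z| <= `|f z'|) = (F (complex.Re z, complex.Im z) <= F (complex.Re z', complex.Im z')).
  by rewrite /F !cplxE -toC_le -!normr_toC_Re.
have [t0 /set_mem At0 ht0] : exists2 c, c \in A & forall t, t \in A -> F t <= F c.
  apply: compact_EVT_max => //; first by exists (complex.Re z1, complex.Im z1); exact: inA.
  exact: continuous_subspaceT.
pose z0 := cplx t0.
have tE t : (complex.Re (cplx t), complex.Im (cplx t)) = t by case: t.
have fmax z : `|f z| <= `|f z0|.
  rewrite F_le tE.
  have [zM|zM] := leP (complex.Re `|z|) M.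
    by apply/ht0/mem_set/inA; rewrite normr_toC_Re toC_le.
  have : `|f z| < `|f z1| by apply: Mout; rewrite normr_toC_Re toC_lt.
  move=> /ltW; rewrite F_le => /le_trans; apply.
  exact/ht0/mem_set/inA.
pose A2 := A `&` (F @^-1` [set x | F t0 <= x]).
have cA2 : compact A2.
  apply: compact_closedI => //; apply: (@closed_comp _ _ F); last exact: closed_ge.
  by move=> t _; exact: Fcont.
have [t2 /set_mem[At2 Ft2] ht2] : exists2 c, c \in A2 & forall t, t \in A2 -> t.1 <= c.1.
  apply: (@compact_EVT_max _ _ fst) => //; first by exists t0; split => //=.
  apply: continuous_subspaceT; move=> t; exact: cvg_fst.
pose z2 := cplx t2.
have fmax2 z : `|f z| <= `|f z2|.
  by rewrite (le_trans (fmax z)) // F_le !tE.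
have [a ha] := fan z2.
have := has_pseries_max_principle ha.
have hn : \forall z \near z2, `|f z| <= `|f z2| by apply: filterE.
move=> /(_ hn) /nbhs_ballP[d /= /lt0_toC[r r0 ->] hd].
have := hd (z2 + toC (r / 2)).
rewrite -ball_normE /= opprD addrA subrr sub0r normrN norm_toC.
rewrite gtr0_norm ?divr_gt0 // toC_lt => h.
have {}h : f (z2 + toC (r / 2)) = f z2.
  by apply: h; rewrite ltr_pdivrMr // ltr_pMr // ltr1n.
set z3 := z2 + _ in h.
have A3 : A2 (complex.Re z3, complex.Im z3).
  split; first by apply/inA/outin; rewrite h.
  have F23 : F t2 = F (complex.Re z3, complex.Im z3) by rewrite /F cplxE h.
  by rewrite /preimage /mkset -F23.
have := ht2 _ (mem_set A3); apply/negP; rewrite -ltNge /= /z2 /=.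
by rewrite ltrDl divr_gt0.
Qed.

Lemma analytic_at_near f g z : (\forall y \near z, f y = g y) ->
  analytic_at f z -> analytic_at g z.
Proof. by move=> fg [a ha]; exists a; exact: has_pseries_near ha. Qed.

Lemma analytic_atB f g z : analytic_at f z -> analytic_at g z ->
  analytic_at (fun y => f y - g y) z.
Proof. by move=> [a ha] [b hb]; eexists; exact: has_pseriesB ha hb. Qed.

Lemma analytic_atZ c f z : analytic_at f z -> analytic_at (fun y => c * f y) z.
Proof. by move=> [a ha]; eexists; exact: has_pseriesZ ha. Qed.

Lemma analytic_at_cst c z : analytic_at (fun=> c) z.
Proof. by eexists; exact: has_pseries_cst. Qed.

Lemma analytic_at_divX c f z : c != z -> analytic_at f z ->
  analytic_at (fun y => f y / (y - c)) z.
Proof.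
by move=> cz [a ha]; exact: (has_pseries_divX (@cvg_exp_half R) ha cz).
Qed.

Lemma near_neq c z : c != z -> \forall y \near z, y != c.
Proof.
move=> cz; apply/nbhs_ballP; exists `|z - c|; first by rewrite /= normr_gt0 subr_eq0 eq_sym.
by move=> y; rewrite -ball_normE /=; apply: contraTneq => ->; rewrite ltxx.
Qed.

Lemma analytic_at_quotient f z0 : analytic_at f z0 ->
  exists c, analytic_at (fun z => if z == z0 then c else (f z - f z0) / (z - z0)) z0.
Proof. by move=> [a ha]; eexists; eexists; exact: has_pseries_shift ha. Qed.

(** [f = O(z^(n-1))], multiplied through by [z] so that [n = 0] covers decay like [1/z]; for a
    polynomial, [n] then bounds the size. *)
Definition grows f (n : nat) := exists K B : R,
  forall z, toC B <= `|z| -> `|f z| * `|z| <= toC K * `|z| ^+ n.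

Lemma growsP f n : grows f n -> exists K B : R, [/\ 0 < K, 1 <= B &
  forall z, toC B <= `|z| -> `|f z| * `|z| <= toC K * `|z| ^+ n].
Proof.
move=> [K [B h]]; exists (`|K| + 1), (`|B| + 1); split.
- by rewrite ltr_wpDl.
- by rewrite lerDr.
move=> z hz; have hB : toC B <= `|z|.
  by rewrite (le_trans _ hz) // toC_le ler_wpDr // ler_norm.
rewrite (le_trans (h z hB)) // ler_wpM2r ?exprn_ge0 // toC_le.
by rewrite ler_wpDr // ler_norm.
Qed.

Lemma growsB f g n : grows f n -> grows g n -> grows (fun z => f z - g z) n.
Proof.
move=> /growsP[K [B [K0 B1 h]]] /growsP[K' [B' [K'0 B'1 h']]].
exists (K + K'), (B + B') => z hz.
have hB : toC B <= `|z| by rewrite (le_trans _ hz) // toC_le; lra.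
have hB' : toC B' <= `|z| by rewrite (le_trans _ hz) // toC_le; lra.
rewrite (le_trans (y := (`|f z| + `|g z|) * `|z|)) //.
  by rewrite ler_wpM2r // ler_normB.
by rewrite mulrDl rmorphD /= mulrDl lerD ?h ?h'.
Qed.

Lemma grows_near f g n (B : R) : (forall z, toC B <= `|z| -> f z = g z) ->
  grows f n -> grows g n.
Proof.
move=> fg /growsP[K [B' [K0 B1 h]]]; exists K, (`|B| + B') => z hz.
have nB : 0 <= `|B| by [].
have lB := ler_norm B.
rewrite -fg ?h // (le_trans _ hz) // toC_le; lra.
Qed.

Lemma grows_divX (r c : C) n : grows (fun z => r / (z - c)) n.
Proof.
exists (2 * complex.Re `|r|), (2 * complex.Re `|c| + 1) => z hz.
have c0 : 0 <= complex.Re `|c| by rewrite -toC_le -normr_toC_Re; exact: normr_ge0.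
have z1 : 1 <= `|z| by rewrite (le_trans _ hz) // -[1]/(toC 1) toC_le; lra.
have z0 : 0 < `|z| by rewrite (lt_le_trans ltr01).
have hc : `|c| * 2 <= `|z|.
  have -> : `|c| * 2 = toC (2 * complex.Re `|c|).
    by rewrite rmorphM rmorph_nat /= -normr_toC_Re mulrC.
  by rewrite (le_trans _ hz) // toC_le; lra.
have zc : `|z| <= 2 * `|z - c|.
  have := lerB_dist z c => h; rewrite -(ler_pM2l (ltr0n C 2)) in h.
  apply: le_trans h; rewrite mulrBr mulr_natl mulr2n (mulrC 2) lerBrDr lerD2l //.
have zc0 : 0 < `|z - c|.
  by rewrite -(pmulr_rgt0 _ (ltr0n C 2)) (lt_le_trans z0).
rewrite normrM normfV rmorphM /= -normr_toC_Re rmorph_nat.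
rewrite (le_trans (y := 2 * `|r|)) //; last first.
  by rewrite ler_peMr ?mulr_ge0 // exprn_ege1.
by rewrite mulrAC ler_pdivrMr // mulrAC mulrC ler_wpM2r.
Qed.

(** Passing to [(f z - f 0) / z] lowers the growth by one; the induction ends at a function decaying
    like [1/z], which vanishes. *)
Lemma entire_poly f n : (forall z, analytic_at f z) -> grows f n ->
  exists2 p : {poly C}, (size p <= n)%N & forall z, f z = p.[z].
Proof.
elim: n f => [|n IH] f fan.
  move=> [K [B h]]; exists 0; first by rewrite size_poly0.
  move=> z; rewrite horner0; apply: (bounded_entire_eq0 (K := K) (B := B)) => // y hy.
  by rewrite (le_trans (h y hy)) // expr0 mulr1.
move=> /growsP[K [B [K0 B1 h]]].
have [c hc] := analytic_at_quotient (fan 0).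
set g := (fun z => _) in hc.
have [z||p sp gp] := IH g.
- have [->//|z0] := eqVneq z 0.
  apply: (@analytic_at_near (fun y => (f y - f 0) / (y - 0))).
    have z0' : 0 != z by rewrite eq_sym.
    have hn := near_neq z0'.
    by apply: filterS hn => y /negbTE y0; rewrite /g y0.
  apply: analytic_at_divX; first by rewrite eq_sym.
  exact: analytic_atB (fan z) (analytic_at_cst _ _).
- exists (K + complex.Re `|f 0|), B => z hz.
  have z1 : 1 <= `|z| by rewrite (le_trans _ hz) // -[1]/(toC 1) toC_le.
  have z0 : 0 < `|z| by rewrite (lt_le_trans ltr01).
  rewrite /g; case: eqP z0 => [->|_ z0]; first by rewrite normr0 ltxx.
  rewrite subr0 normrM normfV divfK ?gt_eqF // (le_trans (ler_normB _ _)) //.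
  rewrite rmorphD /= -normr_toC_Re mulrDl lerD //.
    by rewrite -(ler_pM2r z0) -mulrA -exprSr h.
  by rewrite ler_peMr // exprn_ege1.
exists (p * 'X + (f 0)%:P).
  by rewrite size_MXaddC; case: ifP.
move=> z; rewrite hornerMXaddC -gp /g; case: eqP => [->|/eqP z0].
  by rewrite mulr0 add0r.
by rewrite subr0 divfK // subrK.
Qed.

(** Principal parts are subtracted one pole at a time. Each is [O(1/z)], so the growth exponent is
    unchanged and an entire function of polynomial growth remains. *)
Lemma meromorphic_decomposition (xs : seq C) (rr : C -> C) f n : uniq xs ->
  (forall z, z \notin xs -> analytic_at f z) ->
  (forall x, x \in xs -> exists2 G, analytic_at G x &
     \forall z \near x^', f z = rr x / (z - x) + G z) ->
  grows f n ->
  exists2 p : {poly C}, (size p <= n)%N &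
    forall z, z \notin xs -> f z = \sum_(x <- xs) rr x / (z - x) + p.[z].
Proof.
elim: xs f => [|x xs IH] f.
  move=> _ fan _ /(entire_poly _)[z|p sp fp]; first exact: fan.
  by exists p => // z _; rewrite big_nil add0r.
move=> /= /andP[xxs uxs] fan fpole fg.
have [G Gan Gf] := fpole x (mem_head _ _).
(* The value at the pole is replaced by that of the regular part, since [f x] is arbitrary. *)
pose f1 z := if z == x then G x else f z - rr x / (z - x).
have f1E z : z != x -> f1 z = f z - rr x / (z - x) by rewrite /f1 => /negbTE ->.
have divan z : z != x -> analytic_at (fun z => rr x / (z - x)) z.
  by move=> zx; apply: analytic_at_divX; [rewrite eq_sym|exact: analytic_at_cst].
have [|||p sp f1p] := IH f1 uxs.
- move=> z zxs; have [->|zx] := eqVneq z x.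
    apply: analytic_at_near Gan.
    have : \forall z \near x, z != x -> f z = rr x / (z - x) + G z by exact: Gf.
    apply: filterS => y h; rewrite /f1; case: eqP => [->//|/eqP yx].
    by rewrite h // addrAC subrr add0r.
  apply: (@analytic_at_near (fun z => f z - rr x / (z - x))).
    have xz : x != z by rewrite eq_sym.
    have hn := near_neq xz.
    by apply: filterS hn => y yx; rewrite f1E.
  by apply: analytic_atB; [apply: fan; rewrite inE negb_or zx|exact: divan].
- move=> y yxs; have yx : y != x by apply: contraNneq xxs => <-.
  have [|G1 G1an G1f] := fpole y; first by rewrite inE yxs orbT.
  exists (fun z => G1 z - rr x / (z - x)); first exact: analytic_atB G1an (divan y yx).
  have h1 : \forall z \near y^', z != x.
    by apply: nbhs_dnbhs; apply: near_neq; rewrite eq_sym.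
  by apply: filterS2 G1f h1 => z hz zx; rewrite f1E // hz addrA.
- apply: (@grows_near (fun z => f z - rr x / (z - x)) _ _ (complex.Re `|x| + 1)).
    move=> z hz; rewrite f1E //; apply: contraTneq hz => ->.
    by rewrite normr_toC_Re toC_le -ltNge ltrDl.
  exact: growsB fg (grows_divX _ _ _).
exists p => // z; rewrite inE negb_or big_cons => /andP[zx zxs].
by rewrite -addrA -f1p // f1E // addrC subrK.
Qed.

End Liouville.

(** * The discrete Riemann-Hilbert problem *)

Section GrowthAtInfinity.
Context {R : realType}.
Local Notation C := (Cx R).
Implicit Types (f g : C -> C) (z : C).

Lemma analytic_at_mulX f z : analytic_at f z -> analytic_at (fun y => y * f y) z.
Proof.
move=> [a ha]; exists (fun k => z * a k + if k is k'.+1 then a k' else 0).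
apply: filterS ha => y hy.
set w := y - z in hy *.
have <- : (z + w) * f y = y * f y by rewrite subrKC.
have shiftE u l : (series u @ \oo --> l) = ((fun n => series u n.+1) @ \oo --> (l : C)).
  by rewrite (cvg_shiftS (series u)).
rewrite shiftE.
have -> : (fun n => series (fun k => (z * a k + if k is k'.+1 then a k' else 0) * w ^+ k) n.+1)
  = (fun n => z * series (fun k => a k * w ^+ k) n.+1 + w * series (fun k => a k * w ^+ k) n).
  apply/funext => n; rewrite /series /=.
  under eq_bigr do rewrite mulrDl.
  rewrite big_split /= mulr_sumr; congr (_ + _).
    by apply: eq_bigr => i _; rewrite mulrA.
  rewrite big_nat_recl //= mul0r add0r mulr_sumr.
  by apply: eq_bigr => i _; rewrite exprS mulrCA.
rewrite mulrDl; apply: cvgD; apply: cvgMr => //.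
by move: hy; rewrite shiftE.
Qed.

Lemma analytic_at_horner (p : {poly C}) z : analytic_at (horner p) z.
Proof.
elim/poly_ind: p => [|p c IH].
  apply: analytic_at_near (analytic_at_cst 0 z).
  by apply: filterE => y; rewrite horner0.
have h := analytic_atB (analytic_at_mulX IH) (analytic_at_cst (- c) z).
apply: analytic_at_near h.
by apply: filterE => y; rewrite hornerMXaddC opprK mulrC.
Qed.

Lemma horner_continuous (p : {poly C}) z : horner p @ z --> p.[z].
Proof. by have [a ha] := analytic_at_horner p z; exact: has_pseries_continuous ha. Qed.

Lemma grows_cst_eq0 (c : C) : grows (fun=> c) 0 -> c = 0.
Proof.
move=> h; have [z|p sp /(_ 0) ->] := entire_poly _ h; first exact: analytic_at_cst.
by move: sp; rewrite leqn0 size_poly_eq0 => /eqP ->; rewrite horner0.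
Qed.

Lemma grows_ext f g n : f =1 g -> grows f n -> grows g n.
Proof. by move=> fg; apply: (grows_near (B := 0)) => z _; exact: fg. Qed.

Lemma grows0 n : grows (fun=> 0 : C) n.
Proof. by exists 0, 0 => z _; rewrite normr0 !mul0r. Qed.

Lemma growsD f g n : grows f n -> grows g n -> grows (fun z => f z + g z) n.
Proof.
move=> hf hg; have := growsB hf (growsB (grows0 n) hg).
by apply: grows_ext => z; rewrite sub0r opprK.
Qed.

Lemma grows_sum s (r : nat -> C) (c : nat -> C) n :
  grows (fun z => \sum_(x < s) r x / (z - c x)) n.
Proof.
elim: s => [|s IH].
  by apply: grows_ext (grows0 n) => z; rewrite big_ord0.
apply: grows_ext (growsD IH (grows_divX (r s) (c s) n)) => z.
by rewrite big_ord_recr.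
Qed.

Lemma growsW f n k : (n <= k)%N -> grows f n -> grows f k.
Proof.
move=> nk /growsP[K [B [K0 B1 h]]]; exists K, B => z hz.
rewrite (le_trans (h z hz)) // ler_wpM2l //; first by rewrite -[0]/(toC 0) toC_le ltW.
apply: ler_weXn2l nk; rewrite (le_trans _ hz) // -[1]/(toC 1) toC_le //.
Qed.

Lemma grows_mulXn f n k : grows (fun z => f z * z ^+ k) n -> grows f (n - k).
Proof.
move=> /growsP[K [B [K0 B1 h]]]; exists K, B => z hz.
have z1 : 1 <= `|z| by rewrite (le_trans _ hz) // -[1]/(toC 1) toC_le.
have zk : 0 < `|z| ^+ k by rewrite exprn_gt0 // (lt_le_trans ltr01).
have toK : 0 <= toC K by rewrite -[0]/(toC 0) toC_le ltW.
rewrite -(ler_pM2r zk).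
have -> : `|f z| * `|z| * `|z| ^+ k = `|f z * z ^+ k| * `|z|.
  by rewrite normrM normrX mulrAC.
rewrite (le_trans (h z hz)) // -mulrA -exprD ler_wpM2l // ler_weXn2l //.
by rewrite addnC -leq_subLR.
Qed.

Lemma grows_cst (c : C) n : grows (fun=> c) n.+1.
Proof.
exists (complex.Re `|c|), 1 => z hz; rewrite -normr_toC_Re ler_wpM2l //.
by rewrite exprS ler_peMr // exprn_ege1.
Qed.

Lemma eventually_off_nodes s (c : nat -> C) :
  exists B : R, forall z, toC B <= `|z| -> forall x, (x < s)%N -> z - c x != 0.
Proof.
elim: s => [|s [B hB]]; first by exists 0.
have B0 := ler_norm B; have B0' := normr_ge0 B.
have cs : 0 <= complex.Re `|c s| by rewrite -toC_le -normr_toC_Re; exact: normr_ge0.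
exists (`|B| + complex.Re `|c s| + 1) => z hz x; rewrite ltnS leq_eqVlt.
case/orP => [/eqP ->|].
  rewrite subr_eq0; apply: contraTneq hz => ->.
  by rewrite normr_toC_Re toC_le -ltNge; lra.
by apply: hB; rewrite (le_trans _ hz) // toC_le; lra.
Qed.

(** A Cauchy sum generates its moments at infinity: [z S_k = mu_k + S_(k+1)], where [S_k] has
    weights [r c^k]. As long as the earlier moments vanish, [S_k = z^k S_0], so the assumed decay
    determines [mu_k] as a constant that is [O(1/z)] up to [e]. *)
Lemma moments_at_infinity s (r c : nat -> C) (N : nat) (e : C) :
  grows (fun z => (\sum_(x < s) r x / (z - c x)) * z ^+ N - e) 0 ->
  forall k, (k < N)%N -> \sum_(x < s) r x * c x ^+ k = if k.+1 == N then e else 0.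
Proof.
move=> hS; have [B hB] := eventually_off_nodes s c.
pose S k z := \sum_(x < s) (r x * c x ^+ k) / (z - c x).
pose mu k := \sum_(x < s) r x * c x ^+ k.
have S0 z : S 0 z = \sum_(x < s) r x / (z - c x).
  by apply: eq_bigr => x _; rewrite expr0 mulr1.
have rec k z : toC B <= `|z| -> z * S k z = mu k + S k.+1 z.
  move=> hz; rewrite /S mulr_sumr -big_split /=; apply: eq_bigr => x _.
  have := hB z hz x (ltn_ord x); rewrite exprSr => zc.
  by move: (c x ^+ k) => ck; field.
have muS k : (forall j, (j < k)%N -> mu j = 0) -> forall z, toC B <= `|z| ->
    S k z = z ^+ k * S 0 z.
  elim: k => [|k IH] muk z hz; first by rewrite mul1r.
  have := rec k z hz; rewrite muk // add0r => <-.
  by rewrite IH ?mulrA ?exprS // => j jk; apply: muk; exact: ltnW.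
move=> k; have [n] := ubnP k; elim: n k => // n IH k kn kN.
have muj j : (j < k)%N -> mu j = 0.
  move=> jk; have jN : (j.+1 < N)%N := leq_ltn_trans jk kN.
  by rewrite [mu j](IH j (leq_trans jk kn) (ltnW jN)) ltn_eqF.
have Sg j : grows (S j) 0 by exact: (grows_sum s (fun x => r x * c x ^+ j) c 0).
case: eqP => [kE|/eqP kN'].
  apply/eqP; rewrite -subr_eq0; apply/eqP/grows_cst_eq0.
  apply: (@grows_near _ _ _ _ B _ (growsB hS (Sg k.+1))) => z hz.
  rewrite -S0 mulrC -kE exprS -mulrA -muS // rec // -/(mu k).
  by move: (mu k) (S k.+1 z) => x y; ring.
have kN2 : (k.+1 < N)%N by rewrite ltn_neqAle kN' kN.
have hS1 : grows (fun z => S 0 z * z ^+ k.+1) 0.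
  have -> : 0%N = (1 - (N - k.+1))%N by apply/esym/eqP; rewrite subn_eq0 subn_gt0.
  apply: grows_mulXn; apply: grows_ext (growsD (growsW (leq0n 1) hS) (grows_cst e 0)).
  by move=> z; rewrite subrK -mulrA -exprD subnKC // S0.
apply/grows_cst_eq0; apply: (@grows_near _ _ _ _ B _ (growsB hS1 (Sg k.+1))) => z hz.
by rewrite mulrC exprS -mulrA -muS // rec // addrK.
Qed.

Lemma near_notin (xs : seq C) z : \forall y \near z^', y \notin xs.
Proof.
elim: xs => [|c xs IH]; first by apply: filterE.
have h : \forall y \near z^', y != c.
  have [->|cz] := eqVneq c z; first exact: nbhs_dnbhs_neq.
  by apply: nbhs_dnbhs; exact: near_neq.
by apply: filterS2 IH h => y h1 h2; rewrite inE negb_or h1 h2.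
Qed.

Lemma punctured_limit f g z : f @ z --> f z ->
  (\forall y \near z^', g y = f y) -> g @ z^' --> f z.
Proof.
move=> fc gf; have h : f @ z^' --> f z.
  by move=> A hA; exact: (nbhs_dnbhs (fc A hA)).
move=> A hA; have hA' : \forall y \near z^', A (f y) by exact: h hA.
suff : \forall y \near z^', A (g y) by [].
by apply: filterS2 gf hA' => y ->.
Qed.

End GrowthAtInfinity.

Lemma ord2P (i : 'I_2) : i = 0 \/ i = 1.
Proof. by case: i => [[|[|i]]] hi //; [left|right]; exact: val_inj. Qed.

Lemma sum_ord2 (V : nmodType) (F : 'I_2 -> V) : \sum_(k < 2) F k = F 0 + F 1.
Proof. by rewrite !big_ord_recl big_ord0 addr0; congr (_ + F _); exact: val_inj. Qed.

(** * Solutions of the Riemann-Hilbert problem as orthogonal polynomials *)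

Section Structure.
Context {R : realType} (p : qRacah_param R).
Local Notation C := (Cx R).
Local Notation pi x := (toC (node p x)).
Local Notation w x := (toC (omega p x)).
Local Notation N := (rN p).

Definition cauchy (s : nat) (P : {poly C}) (z : C) : C :=
  \sum_(x < s) w x * P.[pi x] / (z - pi x).

(* The first column (P, Q) of m_s consists of polynomials: P is monic
   orthogonal of degree N and Q is orthogonal of degree < N, normalized. *)
Definition is_OP_solution (s : nat) (m : C -> 'M[C]_2) (P Q : {poly C}) : Prop :=
  [/\ (size (P - 'X^N)%R <= N)%N /\ (size Q <= N)%N,
      forall z, z \notin poles p s ->
        m z = mx2 P.[z] (cauchy s P z) Q.[z] (cauchy s Q z),
      forall x, (x < s)%N -> w x != 0 /\ (P.[pi x] != 0 \/ Q.[pi x] != 0),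
      forall k, (k < N)%N -> \sum_(x < s) w x * P.[pi x] * pi x ^+ k = 0 &
      forall k, (k < N)%N -> \sum_(x < s) w x * Q.[pi x] * pi x ^+ k = (k.+1 == N)%:R].

(** The residue matrices have zero first column: the first column of [m] has removable
    singularities, and the residues of the second are read off from it. The normalization at
    infinity bounds the degrees and gives the moments. A residue being nonzero yields both
    [w x != 0] and the nonvanishing of [(P, Q)] at the node. *)
Lemma DRHP_structure (s : nat) (m : C -> 'M[C]_2) :
  injective (node p) -> (0 < N)%N -> solves_DRHP p s m ->
  exists P Q, is_OP_solution s m P Q.
Proof.
move=> piI N0 [man mres [K [B mK]]].
have mz i j z : (m z *m mx2 (z ^- N) 0 0 (z ^+ N)) i j =
    if j == 0 then m z i 0 * z ^- N else m z i 1 * z ^+ N.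
  rewrite mxE sum_ord2 !mxE /=.
  by case: ifP => _; rewrite mulr0 ?addr0 ?add0r.
have polesP z : reflect (exists2 x, (x < s)%N & z = pi x) (z \in poles p s).
  apply: (iffP mapP) => [[x]|[x]].
    by rewrite mem_iota => xs ->; exists x.
  by move=> xs ->; exists x => //; rewrite mem_iota.
have upoles : uniq (poles p s).
  by rewrite map_inj_uniq ?iota_uniq // => x y /complexI/piI.
have res x : (x < s)%N -> exists r, [/\ simple_pole m (pi x) r,
    forall i, r i 0 = 0 &
    forall i, (fun z => m z i 0 * w x) @ (pi x)^' --> r i 1].
  move=> xs; have [r rp rl] := mres x xs; exists r; split=> // i.
    have h : (fun z => (m z *m mx2 0 (w x) 0 0) i 0) @ (pi x)^' --> r i 0.
      exact: (continuous_cvg _ (@coord_continuous _ _ _ i 0 r) rl).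
    apply/esym; apply: (cvgC_unique _ h); apply: cvg_near_cst; apply: filterE => z.
    by rewrite mxE sum_ord2 !mxE /= !mulr0 addr0.
  have h : (fun z => (m z *m mx2 0 (w x) 0 0) i 1) @ (pi x)^' --> r i 1.
    exact: (continuous_cvg _ (@coord_continuous _ _ _ i 1 r) rl).
  have -> // : (fun z => m z i 0 * w x) = (fun z => (m z *m mx2 0 (w x) 0 0) i 1).
  by apply/funext => z; rewrite mxE sum_ord2 !mxE /= mulr0 addr0.
have mK' i j : grows (fun z => (m z *m mx2 (z ^- N) 0 0 (z ^+ N) - 1) i j) 0.
  exists K, (`|B| + 1) => z hz; rewrite expr0 mulr1.
  have B0 := ler_norm B; have B0' := normr_ge0 B.
  have z0 : 0 < `|z| by rewrite (lt_le_trans _ hz) // -[0]/(toC 0) toC_lt; lra.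
  rewrite -ler_pdivlMr //; apply: mK; rewrite (le_trans _ hz) // toC_le; lra.
have col0 i : exists2 p0 : {poly C}, forall z, z \notin poles p s -> m z i 0 = p0.[z] &
   (size (p0 - (if i == 0 then 'X^N else 0))%R <= N)%N.
  set p1 := if _ then _ else _.
  have [|x||p2 sp2 p2E] := @meromorphic_decomposition R (poles p s) (fun=> 0)
      (fun z => m z i 0 - p1.[z]) N upoles.
  - by move=> z /man/(_ i 0) h; exact: analytic_atB h (analytic_at_horner _ _).
  - case/polesP => y ys ->; have [r [[_ [G Gan GE]] r0 _]] := res y ys.
    exists (fun z => G z i 0 - p1.[z]).
      exact: analytic_atB (Gan i 0) (analytic_at_horner _ _).
    apply: filterS GE => z ->.
    by rewrite !mxE r0 mulr0 mul0r !add0r.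
  - have h := mK' i 0.
    have [K1 [B1 [K10 B11 hK]]] := growsP h.
    exists K1, B1 => z hz; have := hK z hz; rewrite mxE mz eqxx expr0 mulr1.
    have z0 : 0 < `|z| by rewrite (lt_le_trans ltr01) // (le_trans _ hz) // -[1]/(toC 1) toC_le.
    have zN : 0 < `|z| ^+ N by rewrite exprn_gt0.
    move=> hK1; rewrite -(ler_pM2r zN) in hK1; apply: le_trans hK1.
    rewrite mulrAC le_eqVlt; apply/orP; left; apply/eqP; congr (_ * _).
    rewrite -normrX -normrM; congr (`|_|).
    have zN0 : z ^+ N != 0 by rewrite expf_neq0 // -normr_gt0.
    rewrite mulrDl mulfVK // !mxE /p1.
    have [->|i0] := eqVneq i 0; first by rewrite hornerXn mulN1r.
    by rewrite horner0 oppr0 mul0r.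
  exists (p2 + p1); last by rewrite addrK.
  move=> z hz; have := p2E z hz; rewrite big1 ?add0r => [/eqP|x _]; last by rewrite mul0r.
  by rewrite subr_eq hornerD => /eqP.
have resE i P x (r : 'M[C]_2) : (forall z, z \notin poles p s -> m z i 0 = P.[z]) ->
    (fun z => m z i 0 * w x) @ (pi x)^' --> r i 1 -> r i 1 = P.[pi x] * w x.
  move=> mP rl; have hn := near_notin (poles p s) (pi x).
  have mP' : \forall z \near (pi x)^', m z i 0 = P.[z].
    by apply: filterS hn => z; exact: mP.
  have h := punctured_limit (@horner_continuous R P (pi x)) mP'.
  by apply: (cvgC_unique rl); exact: (cvgMl h).
have col1 i P : (forall z, z \notin poles p s -> m z i 0 = P.[z]) ->
   forall z, z \notin poles p s -> m z i 1 = cauchy s P z.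
  move=> mP.
  (* Residues are indexed by complex points, so the number of a node is recovered from its position
     among the poles. *)
  pose rr y := w (index y (poles p s)) * P.[y].
  have idx x : (x < s)%N -> index (pi x) (poles p s) = x.
    move=> xs; have szp : size (poles p s) = s by rewrite size_map size_iota.
    have -> : pi x = nth 0 (poles p s) x.
      by rewrite (nth_map 0%N) ?size_iota // nth_iota.
    by rewrite index_uniq // szp.
  have [|x||q2 sq2 q2E] := @meromorphic_decomposition R (poles p s) rr
      (fun z => m z i 1) 0 upoles.
  - by move=> z /man/(_ i 1).
  - case/polesP => y ys ->; have [r [[_ [G Gan GE]] _ rl]] := res y ys.
    exists (fun z => G z i 1) => //.
    have rE := resE i P y r mP (rl i).
    by apply: filterS GE => z ->; rewrite !mxE rE /rr idx // mulrC (mulrC P.[_]).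
  (* The second column times [z^N] is bounded; as [N >= 1], the column itself is [O(1/z)], which
     leaves no polynomial part. *)
  - have h := mK' i 1; have N1 : (1 - N <= 0)%N by rewrite leqn0 subn_eq0.
    apply: (growsW N1); apply: grows_mulXn.
    apply: grows_ext (growsD (growsW (leq0n 1) h) (grows_cst ((1 : 'M[C]_2) i 1) 0)) => z.
    by rewrite mxE mz /= [X in _ + X + _]mxE subrK.
  move: sq2; rewrite leqn0 size_poly_eq0 => /eqP q20.
  move=> z hz; rewrite q2E // q20 horner0 addr0 /poles big_map.
  have -> : iota 0 s = index_iota 0 s by rewrite /index_iota subn0.
  by rewrite big_mkord; apply: eq_bigr => x _; rewrite /rr idx.
have [P PE sP] := col0 0; have [Q QE sQ] := col0 1.
rewrite /= subr0 in sP sQ.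
have mPE := col1 _ _ PE; have mQE := col1 _ _ QE.
have [B1 hB1] := eventually_off_nodes s (fun x => pi x).
have off z : toC B1 <= `|z| -> z \notin poles p s.
  move=> hz; apply/polesP => -[x xs zx].
  by have := hB1 z hz x xs; rewrite zx subrr eqxx.
exists P, Q; split => //.
- move=> z hz; apply/matrixP => i j; rewrite mxE.
  by have [->|->] := ord2P i; have [->|->] := ord2P j; rewrite /= ?PE ?QE ?mPE ?mQE.
- move=> x xs; have [r [[/eqP r0 _] rc0 rl]] := res x xs.
  have rP := resE _ _ _ _ PE (rl 0); have rQ := resE _ _ _ _ QE (rl 1).
  have rE : r 0 1 = 0 -> r 1 1 = 0 -> False.
    move=> h0 h1; apply: r0; apply/matrixP => i j; rewrite mxE.
    by have [->|->] := ord2P i; have [->|->] := ord2P j.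
  split; first by apply/eqP => wx; apply: rE; rewrite ?rP ?rQ wx mulr0.
  have [P0|] := eqVneq P.[pi x] 0; last by left.
  have [Q0|] := eqVneq Q.[pi x] 0; last by right.
  by case: rE; rewrite ?rP ?rQ ?P0 ?Q0 mul0r.
- move=> k kN.
  have h : grows (fun z => (\sum_(x < s) (w x * P.[pi x]) / (z - pi x)) * z ^+ N - 0) 0.
    apply: (@grows_near _ _ _ _ B1 _ (mK' 0 1)) => z hz.
    by rewrite mxE mz mPE ?off //= !mxE.
  by rewrite (moments_at_infinity (c := fun x => pi x) (r := fun x => w x * P.[pi x]) h kN) if_same.
- move=> k kN.
  have h : grows (fun z => (\sum_(x < s) (w x * Q.[pi x]) / (z - pi x)) * z ^+ N - 1) 0.
    apply: (@grows_near _ _ _ _ B1 _ (mK' 1 1)) => z hz.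
    by rewrite mxE mz mQE ?off //= !mxE.
  rewrite (moments_at_infinity (c := fun x => pi x) (r := fun x => w x * Q.[pi x]) h kN).
  by case: ifP.
Qed.

End Structure.

(** * Hankel determinants and gap probabilities *)

Section Algebra.
Context {F : fieldType}.
Implicit Types (P Q f g : {poly F}).

(** Synthetic division: the quotient keeps the top coefficient and takes the value [f'(z)] at [z].
    For [n = 0] the index [n.-1] is 0 and the quotient is the zero polynomial, hence the separate
    case. *)
Lemma poly_quotient f z : exists g, [/\ f = g * ('X - z%:P) + f.[z]%:P,
  forall n, (size f <= n.+1)%N -> (size g <= n)%N /\ g`_n.-1 = (if n is 0%N then 0 else f`_n)
  & g.[z] = f^`().[z]].
Proof.
have /factor_theorem[g gE] : root (f - f.[z]%:P) z.
  by rewrite rootE !hornerE subrr.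
have fE : f = g * ('X - z%:P) + f.[z]%:P by rewrite -gE subrK.
exists g; split => //; last first.
  have := congr1 (fun h : {poly F} => h^`().[z]) fE.
  rewrite derivD derivM derivXsubC derivC addr0 mulr1 hornerD hornerM.
  by rewrite hornerXsubC subrr mulr0 add0r.
move=> n sf; have sg : (size g <= n)%N.
  have [->|g0] := eqVneq g 0; first by rewrite size_poly0.
  have : (size (f - f.[z]%:P)%R <= n.+1)%N.
    rewrite (leq_trans (size_polyD _ _)) // geq_max sf size_polyN.
    exact: leq_trans (size_polyC_leq1 _) _.
  by rewrite gE size_Mmonic ?monicXsubC // size_XsubC addn2.
split=> //; case: n sf sg => [|n] sf sg.
  by move: sg; rewrite leqn0 size_poly_eq0 => /eqP ->; rewrite coef0.
rewrite fE coefD coefC /= addr0 mulrBr coefB coefMX /= coefMC.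
by rewrite [g`_n.+1]nth_default // mul0r subr0.
Qed.

(** The same block matrix is factored with either Schur complement, and the two determinants are
    compared. *)
Lemma det_1D_rank1 n (u : 'cV[F]_n) (v : 'rV[F]_n) :
  \det (1%:M + u *m v) = 1 + (v *m u) 0 0.
Proof.
have h1 : block_mx 1%:M 0 u 1%:M *m block_mx 1%:M (- v) 0 (1%:M + u *m v) =
    block_mx 1%:M (- v) u 1%:M :> 'M[F]_(1 + n).
  by rewrite mulmx_block !mul1mx ?mulmx1 ?mul0mx ?mulmx0 ?addr0 mulmxN addrCA addNr addr0.
have h2 : block_mx 1%:M (- v) 0 1%:M *m block_mx (1%:M + v *m u) 0 u 1%:M =
    block_mx 1%:M (- v) u 1%:M :> 'M[F]_(1 + n).
  by rewrite mulmx_block !mul1mx ?mulmx1 ?mul0mx ?mulmx0 ?add0r mulNmx addrK.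
have := congr1 determinant (etrans h1 (esym h2)).
rewrite !det_mulmx !det_lblock !det_ublock !det1 !mul1r mulr1 => ->.
by rewrite [X in \det X]mx11_scalar det_scalar1 !mxE eqxx.
Qed.

Definition hankel n (w c : nat -> F) s : 'M[F]_n :=
  \matrix_(i, j) \sum_(x < s) w x * c x ^+ (i + j).

Variables (w c : nat -> F) (N s : nat) (P Q : {poly F}).
Hypotheses (N0 : (0 < N)%N) (sP : (size (P - 'X^N)%R <= N)%N) (sQ : (size Q <= N)%N).
Hypothesis orthP : forall k, (k < N)%N -> \sum_(x < s) w x * P.[c x] * c x ^+ k = 0.
Hypothesis orthQ : forall k, (k < N)%N ->
  \sum_(x < s) w x * Q.[c x] * c x ^+ k = (k.+1 == N)%:R.

Let offnode z := forall x, (x < s)%N -> z - c x != 0.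

Lemma orthP_poly f : (size f <= N)%N -> \sum_(x < s) w x * P.[c x] * f.[c x] = 0.
Proof.
move=> sf; under eq_bigr do rewrite (horner_coef_wide _ sf) mulr_sumr.
rewrite exchange_big /= big1 // => k _.
under eq_bigr do rewrite mulrCA.
by rewrite -mulr_sumr orthP // mulr0.
Qed.

Lemma orthQ_poly f : (size f <= N)%N ->
  \sum_(x < s) w x * Q.[c x] * f.[c x] = f`_N.-1.
Proof.
move=> sf; under eq_bigr do rewrite (horner_coef_wide _ sf) mulr_sumr.
rewrite exchange_big /=.
under eq_bigr => k _ do (under eq_bigr do rewrite mulrCA); 
under eq_bigr => k _ do rewrite -mulr_sumr orthQ //.
have N1 : (N.-1 < N)%N by rewrite prednK.
rewrite (bigD1 (Ordinal N1)) //= prednK // eqxx mulr1 big1 ?addr0 // => k kN.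
case: eqP => [kE|]; last by rewrite mulr0.
by case/negP: kN; apply/eqP/val_inj; rewrite /= -(congr1 predn kE).
Qed.

Let C f z := \sum_(x < s) w x * f.[c x] / (z - c x).

Lemma sizeP : (size P <= N.+1)%N.
Proof.
rewrite -(subrK 'X^N P) (leq_trans (size_polyD _ _)) // geq_max size_polyXn leqnn.
by rewrite (leq_trans sP).
Qed.

Lemma coefPN : P`_N = 1.
Proof.
rewrite -(subrK 'X^N P) coefD coefXn eqxx nth_default ?add0r //.
Qed.

(** Expanding [P.[z]] and [Q.[z]] around each node cancels the poles; by orthogonality only the
    leading coefficient of [P] survives. This is the algebraic form of [det m = 1]. *)
Lemma wronskian_eq1 z : offnode z -> P.[z] * C Q z - Q.[z] * C P z = 1.
Proof.
move=> off.
have [p1 [pE /(_ N sizeP)[sp1 cp1] _]] := poly_quotient P z.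
have [q1 [qE /(_ N (leqW sQ))[sq1 _] _]] := poly_quotient Q z.
transitivity (\sum_(x < s) (w x * P.[c x] * q1.[c x] - w x * Q.[c x] * p1.[c x]) * -1).
  rewrite /C !mulr_sumr -sumrB; apply: eq_bigr => x _.
  have pEx := congr1 (horner^~ (c x)) pE; have qEx := congr1 (horner^~ (c x)) qE.
  rewrite /= !hornerE in pEx qEx.
  have zc := off x (ltn_ord x).
  have -> : P.[z] = P.[c x] + (z - c x) * p1.[c x] by rewrite pEx; ring.
  have -> : Q.[z] = Q.[c x] + (z - c x) * q1.[c x] by rewrite qEx; ring.
  by field.
rewrite -mulr_suml sumrB orthP_poly // orthQ_poly // cp1.
by case: N N0 coefPN => // n _ ->; rewrite sub0r mulrNN mulr1.
Qed.

(* Christoffel-Darboux: (P(z) Q(x) - Q(z) P(x)) / (z - x) reproduces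
   polynomials of degree < N. *)
Lemma christoffel_darboux z : offnode z -> exists K : {poly F},
  [/\ (size K <= N)%N, K.[z] = Q.[z] * P^`().[z] - P.[z] * Q^`().[z] &
   forall f, (size f <= N)%N -> \sum_(x < s) w x * K.[c x] * f.[c x] = f.[z]].
Proof.
move=> off.
have [p1 [pE /(_ N sizeP)[sp1 _] dp]] := poly_quotient P z.
have [q1 [qE /(_ N (leqW sQ))[sq1 _] dq]] := poly_quotient Q z.
exists (Q.[z] *: p1 - P.[z] *: q1); split.
- rewrite (leq_trans (size_polyD _ _)) // size_polyN geq_max.
  by rewrite !(leq_trans (size_scale_leq _ _)).
- by rewrite !hornerE dp dq.
move=> f sf; have [f1 [fE /(_ N.-1)]] := poly_quotient f z.
rewrite prednK // => /(_ sf)[sf1 _] _.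
have sf1' : (size f1 <= N)%N by rewrite (leq_trans sf1) // leq_pred.
have f10 : f1`_N.-1 = 0 by rewrite nth_default.
(* [f.[z]] is multiplied by the Wronskian 1 and completed by two sums that orthogonality
   annihilates, [f1] having degree below [N - 1]; the identity then holds node by node. *)
transitivity (f.[z] * (P.[z] * C Q z - Q.[z] * C P z)
   - P.[z] * (\sum_(x < s) w x * Q.[c x] * f1.[c x])
   + Q.[z] * (\sum_(x < s) w x * P.[c x] * f1.[c x])); last first.
  by rewrite wronskian_eq1 // orthP_poly // orthQ_poly // f10; ring.
rewrite /C !mulr_sumr -sumrB mulr_sumr -sumrB -big_split /=; apply: eq_bigr => x _.
have pEx := congr1 (horner^~ (c x)) pE; have qEx := congr1 (horner^~ (c x)) qE.
have fEx := congr1 (horner^~ (c x)) fE.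
rewrite /= !hornerE in pEx qEx fEx.
have zc := off x (ltn_ord x).
have -> : f.[z] = f.[c x] + (z - c x) * f1.[c x] by rewrite fEx; ring.
rewrite !hornerE /=.
have -> : P.[z] = P.[c x] + (z - c x) * p1.[c x] by rewrite pEx; ring.
have -> : Q.[z] = Q.[c x] + (z - c x) * q1.[c x] by rewrite qEx; ring.
by field.
Qed.

(** The reproducing property tested on monomials. It is phrased without the inverse Hankel matrix
    because invertibility is deduced from it. *)
Lemma hankel_kernel z (K : {poly F}) : (size K <= N)%N ->
  (forall f, (size f <= N)%N -> \sum_(x < s) w x * K.[c x] * f.[c x] = f.[z]) ->
  (\row_(j < N) K`_j) *m hankel N w c s = \row_j z ^+ j.
Proof.
move=> sK hK; apply/rowP => j; rewrite !mxE.
have sX : (size ('X^j : {poly F}) <= N)%N by rewrite size_polyXn.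
rewrite -hornerXn -(hK _ sX).
under eq_bigr do rewrite !mxE mulr_sumr.
rewrite exchange_big /=; apply: eq_bigr => x _.
rewrite (horner_coef_wide _ sK) hornerXn mulr_sumr mulr_suml.
by apply: eq_bigr => i _; rewrite exprD; ring.
Qed.

(** The kernels at [N] distinct points off the nodes multiply the Hankel matrix into a transposed
    Vandermonde matrix, which is invertible. *)
Lemma det_hankel_neq0 (z : nat -> F) : injective z ->
  (forall i, offnode (z i)) -> \det (hankel N w c s) != 0.
Proof.
move=> zI off.
have hK i : exists k : 'rV[F]_N, k *m hankel N w c s = \row_j z i ^+ j.
  have [K [sK _ hK]] := christoffel_darboux (off i).
  by eexists; exact: hankel_kernel sK hK.
pose k i := sval (cid (hK i)).
have kE : (\matrix_(i < N) k i) *m hankel N w c s = (Vandermonde N (\row_j z j))^T.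
  apply/row_matrixP => i; rewrite row_mul rowK (svalP (cid (hK i))).
  by apply/rowP => j; rewrite !mxE.
apply/negP => /eqP d0; have := congr1 determinant kE.
rewrite det_mulmx d0 mulr0 det_tr det_Vandermonde => /esym/eqP; apply/negP.
apply/prodf_neq0 => i _; apply/prodf_neq0 => j ij.
rewrite !mxE subr_eq0; apply: contraTneq ij => /zI ->.
by rewrite ltnn.
Qed.

Lemma det_hankelS : offnode (c s) -> \det (hankel N w c s.+1) =
  \det (hankel N w c s) *
  (1 - w s * (P.[c s] * Q^`().[c s] - Q.[c s] * P^`().[c s])).
Proof.
move=> off; have [K [sK Kz hK]] := christoffel_darboux off.
set H := hankel N w c s; pose k : 'rV[F]_N := \row_(j < N) K`_j.
pose x : 'rV[F]_N := \row_j c s ^+ j.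
have kH : k *m H = x by exact: hankel_kernel sK hK.
(* The new node adds [w s] times [x^T x], and [x = k H] brings [H] out on the right. *)
have -> : hankel N w c s.+1 = (1%:M + (w s *: x^T) *m k) *m H.
  rewrite mulmxDl mul1mx -mulmxA kH; apply/matrixP => i j.
  by rewrite !mxE big_ord_recr big_ord1 /= !mxE exprD; ring.
rewrite det_mulmx det_1D_rank1 mulrC; congr (_ * (1 + _)).
rewrite -scalemxAr mxE.
have -> : (k *m x^T) 0 0 = K.[c s].
  rewrite (horner_coef_wide _ sK) mxE; apply: eq_bigr => i _.
  by rewrite !mxE.
by rewrite Kz; ring.
Qed.

End Algebra.

(** * Andreief's identity for a finite weight *)

Section Andreief.
Context {F : fieldType} (S N : nat) (w c : 'I_S -> F).
Implicit Types (l : N.-tuple 'I_S) (f : {ffun 'I_N -> 'I_S}) (t : 'S_N).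

Definition tuple_sorted l := sorted ltn [seq val i | i <- l].

Let V (g : 'I_N -> 'I_S) := \det (\matrix_(i < N, j < N) c (g i) ^+ j).

Let V2 g : V g ^+ 2 = \prod_(i < N) \prod_(j < N | (i < j)%N) (c (g i) - c (g j)) ^+ 2.
Proof.
have -> : V g = \det (Vandermonde N (\row_j c (g j))).
  by rewrite -det_tr; congr (\det _); apply/matrixP => i j; rewrite !mxE.
rewrite det_Vandermonde -prodrXl; apply: eq_bigr => i _.
rewrite -prodrXl; apply: eq_bigr => j _.
by rewrite !mxE -sqrrN opprB.
Qed.

Let G f := (\prod_(i < N) (w (f i) * c (f i) ^+ i)) * V f.

(** Leibniz's formula, with each product of sums distributed over the choices [f] of one node per
    row; the sum over permutations then reassembles a Vandermonde determinant. *)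
Let hankelE : \det (\matrix_(i < N, j < N) \sum_x w x * c x ^+ (i + j)) = \sum_f G f.
Proof.
rewrite /determinant.
transitivity (\sum_(t : 'S_N) \sum_(f : {ffun 'I_N -> 'I_S})
    (-1) ^+ t * \prod_(i < N) (w (f i) * c (f i) ^+ (i + t i))).
  apply: eq_bigr => t _; rewrite -big_distrr /=; congr (_ * _).
  rewrite -(bigA_distr_bigA (fun (i : 'I_N) x => w x * c x ^+ (i + t i))).
  by apply: eq_bigr => i _; rewrite mxE.
rewrite exchange_big; apply: eq_bigr => f _ /=.
rewrite /G /V /determinant mulr_sumr; apply: eq_bigr => t _.
rewrite mulrCA -big_split /=; congr (_ * _).
by apply: eq_bigr => i _; rewrite mxE exprD mulrA.
Qed.

Let G_noninj f : ~~ injectiveb f -> G f = 0.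
Proof.
move/injectivePn => [i [j ij fij]]; rewrite /G /V.
rewrite (determinant_alternate ij) ?mulr0 // => k.
by rewrite !mxE fij.
Qed.

Let le_ord : rel 'I_S := relpre val leq.

Definition sort_ffun f : N.-tuple 'I_S := [tuple of sort le_ord [tuple f i | i < N]].

Let h l t : {ffun 'I_N -> 'I_S} := [ffun i => tnth l (t i)].

Let uniq_sort f : uniq (sort_ffun f) = injectiveb f.
Proof.
rewrite sort_uniq /= /injectiveb /dinjectiveb.
by congr uniq; rewrite /image_mem -enumT.
Qed.

Let sorted_sort f : injectiveb f -> tuple_sorted (sort_ffun f).
Proof.
move=> fi; rewrite /tuple_sorted ltn_sorted_uniq_leq map_inj_uniq; last exact: val_inj.
rewrite uniq_sort fi sorted_map; apply: sort_sorted => x y; exact: leq_total.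
Qed.

(** The fibre of sorting over an increasing tuple is its orbit under the symmetric group. *)
Let sort_eq l f : tuple_sorted l ->
  injectiveb f && (sort_ffun f == l) = (f \in h l @: predT).
Proof.
rewrite /tuple_sorted ltn_sorted_uniq_leq map_inj_uniq; last exact: val_inj.
rewrite sorted_map => /andP[ul sl].
have anti : antisymmetric le_ord.
  by move=> x y /anti_leq /val_inj.
have tr : transitive le_ord by move=> x y z; exact: leq_trans.
apply/andP/imsetP => [[fi /eqP fl]|[t _ ->]].
  have : perm_eq [tuple f i | i < N] l by rewrite -fl perm_sym perm_sort.
  case/tuple_permP => t ft; exists t => //; apply/ffunP => i; rewrite ffunE.
  have := congr1 (fun s => nth (f i) s i) ft.
  by rewrite !nth_mktuple.
have hl : perm_eq [tuple h l t i | i < N] l.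
  apply/tuple_permP; exists t; congr val; apply: eq_from_tnth => i.
  by rewrite !tnth_mktuple ffunE.
have sE : sort_ffun (h l t) = l.
  apply/val_inj; apply: (sorted_eq tr anti) => //.
    by apply: sort_sorted => x y; exact: leq_total.
  by rewrite perm_sort.
by rewrite sE eqxx -uniq_sort sE.
Qed.

(** Noninjective choices vanish and the others are grouped by increasing rearrangement. Within a
    group a permutation multiplies [V] by its sign, so the remaining monomials sum up to the second
    factor [V]. *)
Lemma andreief :
  \sum_(l | tuple_sorted l)
     ((\prod_(i < N) \prod_(j < N | (i < j)%N) (c (tnth l i) - c (tnth l j)) ^+ 2)
      * \prod_(i < N) w (tnth l i)) =
  \det (\matrix_(i < N, j < N) \sum_x w x * c x ^+ (i + j)).
Proof.
rewrite hankelE (bigID (fun f : {ffun 'I_N -> 'I_S} => injectiveb f)) /=.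
rewrite [X in _ + X]big1 ?addr0; last exact: G_noninj.
rewrite (partition_big sort_ffun tuple_sorted) /=; last by move=> f; exact: sorted_sort.
apply: eq_bigr => l sl; rewrite (eq_bigl _ _ (fun f => sort_eq f sl)).
have ul : uniq l.
  by move: sl; rewrite /tuple_sorted ltn_sorted_uniq_leq (map_inj_uniq val_inj) => /andP[].
rewrite big_imset /=; last first.
  move=> t t' _ _ /ffunP tt'; apply/permP => i; have := tt' i.
  by rewrite !ffunE => /(tuple_uniqP _ ul).
rewrite (eq_bigl predT); last by move=> t; rewrite inE.
rewrite -V2.
transitivity (\sum_(t : 'S_N) (\prod_(i < N) w (tnth l i)) * V (tnth l) *
     ((-1) ^+ t * \prod_(i < N) c (tnth l (t i)) ^+ i)).
  rewrite -mulr_sumr; have <- : V (tnth l) =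
      \sum_(t : 'S_N) (-1) ^+ t * \prod_(i < N) c (tnth l (t i)) ^+ i.
    rewrite /V -det_tr; apply: eq_bigr => t _; congr (_ * _).
    by apply: eq_bigr => i _; rewrite !mxE.
  by move: (V _) => v; ring.
apply: eq_bigr => t _; rewrite /G.
have -> : V (h l t) = (-1) ^+ t * V (tnth l).
  rewrite /V -det_perm -det_mulmx; congr (\det _).
  rewrite -row_permE; apply/matrixP => i j; rewrite !mxE ffunE //.
have -> : \prod_(i < N) (w (h l t i) * c (h l t i) ^+ i) =
   (\prod_(i < N) w (tnth l i)) * \prod_(i < N) c (tnth l (t i)) ^+ i.
  rewrite big_split /= [X in X * _](reindex_inj (@perm_inj _ (t^-1)%g)) /=.
  congr (_ * _); apply: eq_bigr => i _; last by rewrite ffunE.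
  by rewrite ffunE permKV.
by rewrite mulrACA [RHS]mulrACA; congr (_ * _); exact: mulrC.
Qed.

End Andreief.

(** * Gap probabilities as ratios of Hankel determinants *)

Section Gap.
Context {R : realType} (p : qRacah_param R).
Local Notation N := (rN p).

Lemma last_configE (N1 : (N.-1 < N)%N) (l : N.-tuple 'I_(rM p).+1) :
  last 0%N [seq val i | i <- tval l] = tnth l (Ordinal N1).
Proof.
rewrite -nth_last size_map size_tuple.
rewrite (nth_map (tnth l (Ordinal N1))) ?size_tuple //.
by congr val; exact/esym/tnth_nth.
Qed.

(** The constraint on the last particle is absorbed into the weight, which is set to 0 from [s] on;
    Andreief's identity applies to the truncated weight. *)
Lemma config_sum_hankel s : (0 < N)%N -> (s <= (rM p).+1)%N ->
  \sum_(l : N.-tuple 'I_(rM p).+1 |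
      is_config l && (last 0%N [seq val i | i <- tval l] < s)%N) config_weight l
  = \det (hankel N (omega p) (node p) s).
Proof.
move=> N0 sM.
pose w (x : 'I_(rM p).+1) := if (x < s)%N then omega p x else 0.
have -> : hankel N (omega p) (node p) s =
    \matrix_(i < N, j < N) \sum_(x < (rM p).+1) w x * node p x ^+ (i + j).
  apply/matrixP => i j; rewrite !mxE.
  rewrite (big_ord_widen _ (fun x => omega p x * node p x ^+ (i + j)) sM) big_mkcond.
  by apply: eq_bigr => x _; rewrite /w; case: ifP => // _; rewrite mul0r.
rewrite -andreief big_mkcondr; apply: eq_bigr => l sl.
case: ifP => [ls|/negbT ls].
  congr (_ * _); apply: eq_bigr => i _; rewrite /w.
  suff -> : (tnth l i < s)%N by [].
  have N1 : (N.-1 < N)%N by rewrite prednK.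
  rewrite (last_configE N1) in ls; apply: leq_ltn_trans ls.
  have sl' : sorted leq [seq val i | i <- tval l].
    by move: sl; rewrite /is_config ltn_sorted_uniq_leq => /andP[].
  have := sorted_leq_nth leq_trans leqnn 0%N sl'.
  have nthE (j : 'I_N) : nth 0%N [seq val i | i <- tval l] j = tnth l j.
    rewrite (nth_map (tnth l j)) ?size_tuple //.
    by congr val; exact/esym/tnth_nth.
  move=> /(_ i (Ordinal N1)); rewrite !inE !size_map !size_tuple !ltn_ord nthE (nthE (Ordinal N1)).
  by apply=> //=; rewrite -ltnS prednK.
have N1 : (N.-1 < N)%N by rewrite prednK.
rewrite (last_configE N1) in ls.
by rewrite [X in _ = _ * X](bigD1 (Ordinal N1)) //= /w (negbTE ls) mul0r mulr0.
Qed.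

Lemma gap_probE s : (0 < N)%N -> (s <= (rM p).+1)%N ->
  gap_prob p s = \det (hankel N (omega p) (node p) s) /
                 \det (hankel N (omega p) (node p) (rM p).+1).
Proof.
move=> N0 sM; rewrite /gap_prob /qRacah_prob /= config_sum_hankel //.
congr (_ / _); rewrite -config_sum_hankel //; apply: eq_bigl => l.
have N1 : (N.-1 < N)%N by rewrite prednK.
by rewrite (last_configE N1) ltn_ord andbT.
Qed.

End Gap.

(** * Lax matrices and the recursion *)

Section RationalAt.
Context {R : realType}.
Local Notation C := (Cx R).
Implicit Types (f g : C -> C) (z : C).

(** Only the germ at [z0] matters, and [z0] is not a pole. This class is closed under the operations
    that build the Lax matrices and admits exact division by [z - z0]. *)
Definition rational_at f z0 := exists P Q : {poly C},
  Q.[z0] != 0 /\ \forall z \near z0, f z = P.[z] / Q.[z].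

Lemma analytic_at_continuous f z : analytic_at f z -> f @ z --> f z.
Proof. by move=> [a ha]; exact: has_pseries_continuous ha. Qed.

Lemma continuous_near_neq0 f z : f @ z --> f z -> f z != 0 ->
  \forall y \near z, f y != 0.
Proof.
move=> fc f0; have f0' : 0 != f z by rewrite eq_sym.
exact: (fc _ (near_neq f0')).
Qed.

Lemma continuous_near_notin (xs : seq C) f z : f @ z --> f z -> f z \notin xs ->
  \forall y \near z, f y \notin xs.
Proof.
move=> fc; elim: xs => [|x xs IH]; first by move=> _; apply: filterE.
rewrite inE negb_or eq_sym => /andP[fx /IH h].
have h1 : \forall y \near z, f y != x by exact: (fc _ (near_neq fx)).
by apply: filterS2 h h1 => y hy1 hy2; rewrite inE negb_or hy1 hy2.
Qed.

Lemma rational_at_near f g z : (\forall y \near z, f y = g y) ->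
  rational_at f z -> rational_at g z.
Proof.
move=> fg [P [Q [Q0 h]]]; exists P, Q; split => //.
by apply: filterS2 fg h => y <-.
Qed.

Lemma rational_at_ext f g z : f =1 g -> rational_at f z -> rational_at g z.
Proof. by move=> fg; apply: rational_at_near; apply: filterE. Qed.

Lemma rational_at_horner (P : {poly C}) z : rational_at (horner P) z.
Proof.
exists P, 1; split; first by rewrite hornerE oner_neq0.
by apply: filterE => y; rewrite hornerE divr1.
Qed.

Lemma rational_at_cst c z : rational_at (fun=> c) z.
Proof. by apply: rational_at_ext (rational_at_horner c%:P z) => y; rewrite hornerC. Qed.

Lemma rational_at_id z : rational_at id z.
Proof. by apply: rational_at_ext (rational_at_horner 'X z) => y; rewrite hornerX. Qed.

Lemma near_horner_neq0 (Q : {poly C}) z : Q.[z] != 0 -> \forall y \near z, Q.[y] != 0.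
Proof. by move=> Q0; exact: continuous_near_neq0 (@horner_continuous R Q z) Q0. Qed.

Lemma rational_atD f g z : rational_at f z -> rational_at g z ->
  rational_at (fun y => f y + g y) z.
Proof.
move=> [P [Q [Q0 h]]] [P' [Q' [Q'0 h']]]; exists (P * Q' + P' * Q), (Q * Q').
split; first by rewrite hornerM mulf_neq0.
have hh : \forall y \near z, Q.[y] != 0 /\ Q'.[y] != 0.
  exact: filterI (near_horner_neq0 Q0) (near_horner_neq0 Q'0).
apply: filterS3 h h' hh => y -> -> [n n'].
by rewrite !hornerE; field; rewrite n n'.
Qed.

Lemma rational_atM f g z : rational_at f z -> rational_at g z ->
  rational_at (fun y => f y * g y) z.
Proof.
move=> [P [Q [Q0 h]]] [P' [Q' [Q'0 h']]]; exists (P * P'), (Q * Q').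
split; first by rewrite hornerM mulf_neq0.
by apply: filterS2 h h' => y -> ->; rewrite !hornerM invfM mulrACA.
Qed.

Lemma rational_atN f z : rational_at f z -> rational_at (fun y => - f y) z.
Proof.
move=> /(rational_atM (rational_at_cst (- 1) z)); apply: rational_at_ext => y.
by rewrite mulN1r.
Qed.

Lemma rational_atB f g z : rational_at f z -> rational_at g z ->
  rational_at (fun y => f y - g y) z.
Proof. by move=> hf /rational_atN; exact: rational_atD. Qed.

Lemma rational_atV f z : rational_at f z -> f z != 0 -> rational_at (fun y => (f y)^-1) z.
Proof.
move=> [P [Q [Q0 h]]] f0; exists Q, P; split.
  by apply: contraNneq f0 => P0; rewrite (nbhs_singleton h) P0 mul0r.
by apply: filterS h => y ->; rewrite invf_div.
Qed.

Lemma rational_at_comp_horner (P : {poly C}) f z : rational_at f z ->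
  rational_at (fun y => P.[f y]) z.
Proof.
move=> hf; elim/poly_ind: P => [|P c IH].
  by apply: rational_at_ext (rational_at_cst 0 z) => y; rewrite horner0.
apply: rational_at_ext (rational_atD (rational_atM IH hf) (rational_at_cst c z)) => y.
by rewrite hornerMXaddC.
Qed.

Lemma rational_at_sum n (F : nat -> C -> C) z :
  (forall i, (i < n)%N -> rational_at (F i) z) ->
  rational_at (fun y => \sum_(i < n) F i y) z.
Proof.
elim: n => [|n IH] hF.
  by apply: rational_at_ext (rational_at_cst 0 z) => y; rewrite big_ord0.
have hn : rational_at (fun y => \sum_(i < n) F i y) z.
  by apply: IH => i lin; apply: hF; exact: ltnW.
apply: rational_at_ext (rational_atD hn (hF n (ltnSn n))) => y.
by rewrite big_ord_recr.
Qed.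

(** The denominator splits over an algebraically closed field and is removed one linear factor at a
    time. *)
Lemma rational_at_analytic f z : rational_at f z -> analytic_at f z.
Proof.
move=> [P [Q [Q0 h]]].
have {}h : \forall y \near z, P.[y] / Q.[y] = f y by apply: filterS h => y ->.
apply: analytic_at_near h _; have [n] := ubnP (size Q).
elim: n Q Q0 => // n IH Q Q0 sQ.
have [s1|s1] := eqVneq (size Q) 1%N.
  have /eqP/size_poly1P[c c0 QE] := s1.
  have hc := analytic_atZ c^-1 (analytic_at_horner P z).
  by apply: analytic_at_near hc; apply: filterE => y; rewrite QE hornerC mulrC.
have /closed_rootP[c /factor_theorem[Q1 QE]] := s1.
move: Q0 sQ; rewrite QE hornerM hornerXsubC mulf_eq0 negb_or subr_eq0 => /andP[Q10 cz].
have Q1n : Q1 != 0 by apply: contraNneq Q10 => ->; rewrite horner0.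
rewrite size_Mmonic ?monicXsubC // size_XsubC addn2 ltnS => sQ1.
have cz' : c != z by rewrite eq_sym.
apply: analytic_at_near (analytic_at_divX cz' (IH Q1 Q10 sQ1)).
by apply: filterE => y; rewrite hornerM hornerXsubC invfM mulrA.
Qed.

Lemma rational_at_continuous f z : rational_at f z -> f @ z --> f z.
Proof. by move=> /rational_at_analytic; exact: analytic_at_continuous. Qed.

(** The value of [f1] at [z] is the derivative of [f]. The polynomial [P Q(z) - P(z) Q] vanishes at
    [z], which provides the factor. *)
Lemma rational_at_quotient f z : rational_at f z ->
  exists2 f1, rational_at f1 z & \forall y \near z, f y = f z + (y - z) * f1 y.
Proof.
move=> [P [Q [Q0 h]]]; have fz := nbhs_singleton h.
have /factor_theorem[g gE] : root (P * Q.[z]%:P - P.[z]%:P * Q) z.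
  by rewrite rootE !hornerE; apply/eqP; ring.
exists (fun y => g.[y] / (Q.[y] * Q.[z])).
  exists g, (Q * Q.[z]%:P); split; first by rewrite !hornerE mulf_neq0.
  by apply: filterE => y; rewrite !hornerE.
apply: filterS2 h (near_horner_neq0 Q0) => y -> Qy.
have := congr1 (horner^~ y) gE; rewrite /= !hornerE => E.
rewrite fz /=; apply/eqP; rewrite -subr_eq0; apply/eqP.
transitivity ((P.[y] * Q.[z] - P.[z] * Q.[y] - g.[y] * (y - z)) / (Q.[y] * Q.[z])).
  by field; rewrite Qy Q0.
by rewrite E subrr mul0r.
Qed.

(** Continuity carries an identity into the removed point; this is how relations known off the poles
    are evaluated at a node. *)
Lemma rational_at_eq f g z : rational_at f z -> rational_at g z ->
  (\forall y \near z^', f y = g y) -> f z = g z.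
Proof.
move=> hf hg fg.
have fc := rational_at_continuous hf; have gc := rational_at_continuous hg.
have h1 := punctured_limit gc fg.
have e : \forall y \near z^', f y = f y by apply: filterE.
have h2 := punctured_limit fc e.
exact: cvgC_unique h2 h1.
Qed.

(** The variation of [h] is divisible by [y - z], so freezing the residue at [h z] costs only an
    analytic term. *)
Lemma rational_at_pole F h g z : rational_at h z -> rational_at g z ->
  (\forall y \near z^', F y = (y - z)^-1 * h y + g y) ->
  exists2 G, analytic_at G z & \forall y \near z^', F y = (y - z)^-1 * h z + G y.
Proof.
move=> hh hg hF; have [h1 hh1 hE] := rational_at_quotient hh.
exists (fun y => h1 y + g y).
  exact: rational_at_analytic (rational_atD hh1 hg).
have hE' : \forall y \near z^', h y = h z + (y - z) * h1 y by exact: nbhs_dnbhs hE.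
apply: filterS3 hF hE' (nbhs_dnbhs_neq z) => y -> -> yz.
have yz0 : y - z != 0 by rewrite subr_eq0.
by field.
Qed.

Lemma derive1_mx_rational (F F1 : C -> 'M[C]_2) z :
  (forall i j, rational_at (fun y => F1 y i j) z) ->
  (forall i j, \forall y \near z, F y i j = F z i j + (y - z) * F1 y i j) ->
  'D_1 F z = F1 z.
Proof.
move=> hF1 hF; rewrite /derive.
have hc : h^-1 *: (F (h *: (1 : C) + z) - F z) @[h --> (0 : C)^'] --> F1 z.
  move=> A [U hU UA].
  suff hij i j : \forall h \near (0 : C)^', U i j ((h^-1 *: (F (h *: (1 : C) + z) - F z)) i j).
    have H : \forall h \near (0 : C)^', forall i j,
        U i j ((h^-1 *: (F (h *: (1 : C) + z) - F z)) i j).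
      by apply: filter_forall => i; apply: filter_forall => j; exact: hij.
    suff : \forall h \near (0 : C)^', A (h^-1 *: (F (h *: (1 : C) + z) - F z)) by [].
    by apply: filterS H => h; exact: UA.
  have hz : \forall y \near z, U i j (F1 y i j).
    exact: (rational_at_continuous (hF1 i j) (hU i j)).
  have hI : nbhs z (fun y => U i j (F1 y i j) /\ F y i j = F z i j + (y - z) * F1 y i j).
    exact: filterI hz (hF i j).
  move/nbhs_ballP : hI => [e /= e0 he].
  have hb : \forall h \near (0 : C), `|h| < e.
    apply/nbhs_ballP; exists e => // y.
    by rewrite -ball_normE /= sub0r normrN.
  apply: filterS2 (nbhs_dnbhs hb) (nbhs_dnbhs_neq (0 : C)) => h hle h0.
  have [|U1 FE] := he (h + z).
    by rewrite -ball_normE /= opprD addrCA subrr addr0 normrN.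
  by rewrite !mxE -[h *: 1]/(h * 1) mulr1 FE addrAC subrr add0r addrK mulKf.
exact: (cvg_lim (@norm_hausdorff _ _) hc).
Qed.

End RationalAt.

(** * Two by two matrices and determinants *)

Section TwoByTwo.
Context {R : realType}.
Local Notation C := (Cx R).
Implicit Types (A B : 'M[C]_2) (x y : 'cV[C]_2).

Lemma mulmx2E n (A : 'M[C]_2) (B : 'M[C]_(2, n)) i j :
  (A *m B) i j = A i 0 * B 0 j + A i 1 * B 1 j.
Proof. by rewrite mxE sum_ord2. Qed.

Lemma matrix2P A B : A 0 0 = B 0 0 -> A 0 1 = B 0 1 -> A 1 0 = B 1 0 ->
  A 1 1 = B 1 1 -> A = B.
Proof.
move=> h00 h01 h10 h11; apply/matrixP => i j.
by have [->|->] := ord2P i; have [->|->] := ord2P j.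
Qed.

Lemma colvec2P x y : x 0 0 = y 0 0 -> x 1 0 = y 1 0 -> x = y.
Proof.
move=> h0 h1; apply/matrixP => i j; rewrite ord1.
by have [->|->] := ord2P i.
Qed.

Definition cvec2 (a b : C) : 'cV[C]_2 := \col_i if i == 0 then a else b.

Lemma det2E x y : det2 x y = x 0 0 * y 1 0 - x 1 0 * y 0 0.
Proof.
have E0 i : row_mx x y i (0 : 'I_(1 + 1)) = x i 0.
  by have <- : lshift 1 (0 : 'I_1) = 0 :> 'I_(1 + 1) by [exact: val_inj]; rewrite row_mxEl.
have E1 i : row_mx x y i (1 : 'I_(1 + 1)) = y i 0.
  by have <- : rshift 1 (0 : 'I_1) = 1 :> 'I_(1 + 1) by [exact: val_inj]; rewrite row_mxEr.
have l0 : lift 0 0 = 1 :> 'I_2 by exact: val_inj.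
have l1 : lift 1 0 = 0 :> 'I_2 by exact: val_inj.
rewrite /det2; move: (row_mx x y) E0 E1 => Mx E0 E1.
rewrite (expand_det_row _ 0) sum_ord2 /cofactor !det_mx11 !mxE.
rewrite !(l0, l1) !E0 !E1 /= expr0 mul1r expr1 mulN1r mulrN.
by rewrite (mulrC (y 0 0)).
Qed.

Lemma det2_mul A x y : det2 (A *m x) (A *m y) = \det A * det2 x y.
Proof. by rewrite /det2 -mul_mx_row det_mulmx. Qed.

Lemma det_mx2 a b c d : \det (mx2 a b c d : 'M[C]_2) = a * d - b * c.
Proof.
have := det2_mul (mx2 a b c d) (cvec2 1 0) (cvec2 0 1).
rewrite !det2E !mulmx2E !mxE /= !(mulr0, mulr1, addr0, add0r, subr0) => <-.
by rewrite mulrC [c * b]mulrC mulrC.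
Qed.

Lemma invmx_unique A B : A *m B = 1 -> invmx A = B.
Proof.
move=> AB; have /mulmx1_unit[uA _] := AB.
by rewrite -[B](mulKmx uA) AB mulmx1.
Qed.

End TwoByTwo.

(** * The transfer from [m_s] to [m_(s+1)] *)

Section Transfer.
Context {R : realType} (p : qRacah_param R).
Local Notation C := (Cx R).
Local Notation pi x := (toC (node p x)).
Local Notation w x := (toC (omega p x)).
Local Notation N := (rN p).
Hypotheses (piI : injective (node p)) (N0 : (0 < N)%N).

Lemma polesP s z : reflect (exists2 x, (x < s)%N & z = pi x) (z \in poles p s).
Proof.
apply: (iffP mapP) => [[x]|[x]].
  by rewrite mem_iota => xs ->; exists x.
by move=> xs ->; exists x => //; rewrite mem_iota.
Qed.

Lemma node_notin_poles s x : (s <= x)%N -> pi x \notin poles p s.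
Proof.
move=> sx; apply/polesP => -[y ys /complexI/piI xy].
by move: ys; rewrite -xy ltnNge sx.
Qed.

Lemma notin_poles_sub s z x : z \notin poles p s -> (x < s)%N -> z - pi x != 0.
Proof.
move=> zs xs; rewrite subr_eq0; apply: contraNneq zs => ->.
by apply/polesP; exists x.
Qed.

Lemma notin_polesS s z : z \notin poles p s.+1 -> z \notin poles p s.
Proof.
apply: contra => /polesP[x xs ->]; apply/polesP; exists x => //; exact: ltnW.
Qed.

Lemma cauchyS s P z :
  cauchy p s.+1 P z = cauchy p s P z + w s * P.[pi s] / (z - pi s).
Proof. by rewrite /cauchy big_ord_recr. Qed.

(** Minus the Christoffel-Darboux kernel on the diagonal. *)
Definition kappa (P Q : {poly C}) z := P.[z] * Q^`().[z] - Q.[z] * P^`().[z].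

Lemma OP_wronskian s m P Q z : is_OP_solution p s m P Q -> z \notin poles p s ->
  P.[z] * cauchy p s Q z - Q.[z] * cauchy p s P z = 1.
Proof.
move=> [[sP sQ] _ _ oP oQ] zs.
exact: (@wronskian_eq1 _ (fun x => w x) (fun x => pi x) N s P Q N0 sP sQ oP oQ z
  (fun x xs => notin_poles_sub zs xs)).
Qed.

Lemma OP_det s m P Q z : is_OP_solution p s m P Q -> z \notin poles p s ->
  \det (m z) = 1.
Proof.
move=> h zs; have [_ mE _ _ _] := h; rewrite mE // det_mx2.
by rewrite -(OP_wronskian h zs); ring.
Qed.

Lemma OP_inv s m P Q z : is_OP_solution p s m P Q -> z \notin poles p s ->
  invmx (m z) = mx2 (cauchy p s Q z) (- cauchy p s P z) (- Q.[z]) P.[z].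
Proof.
move=> h zs; have [_ mE _ _ _] := h; have W := OP_wronskian h zs.
apply: invmx_unique; rewrite mE //.
apply: matrix2P; rewrite mulmx2E !mxE /= -?W; ring.
Qed.

Lemma rational_at_cauchy s P f z : rational_at f z -> f z \notin poles p s ->
  rational_at (fun y => cauchy p s P (f y)) z.
Proof.
move=> hf fz.
apply: (rational_at_sum (F := fun x y => w x * P.[pi x] / (f y - pi x))) => x xs.
have h := rational_atB hf (rational_at_cst (pi x) z).
have h0 := notin_poles_sub fz xs.
have r := rational_atM (rational_at_cst (w x * P.[pi x]) z) (rational_atV h h0).
by apply: rational_at_ext r.
Qed.

(** Comparing poles at the new node: the first column of [m'] has none, so [T] kills [(P, Q)] there
    and [(P', Q')] is [(P, Q)] plus the derivative of [T (P, Q)]; the residue of the second column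
    is [w s] times [(P', Q')]. Eliminating [(P', Q')] leaves one scalar equation for [tau]. *)
Lemma transfer_structure s m m' P Q P' Q' (T : 'M[C]_2) :
  is_OP_solution p s m P Q -> is_OP_solution p s.+1 m' P' Q' ->
  (exists k, T ^+ k = 0) ->
  (forall z, z \notin poles p s.+1 -> m' z = (1 + (z - pi s)^-1 *: T) *m m z) ->
  exists tau, tau * (1 - w s * kappa P Q (pi s)) = w s /\
    T *m m (pi s) = m (pi s) *m mx2 0 tau 0 0.
Proof.
move=> h h' [k Tk] mT; set z0 := pi s.
have [_ mE _ _ _] := h; have [_ mE' _ _ _] := h'.
have z0s : z0 \notin poles p s by exact: node_notin_poles.
have W := OP_wronskian h z0s.
pose f (i : 'I_2) := if i == 0 then P else Q.
pose f' (i : 'I_2) := if i == 0 then P' else Q'.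
have mf i z : z \notin poles p s -> m z i 0 = (f i).[z] /\ m z i 1 = cauchy p s (f i) z.
  by move=> zs; rewrite mE // !mxE /f; have [->|->] := ord2P i.
have mf' i z : z \notin poles p s.+1 ->
    m' z i 0 = (f' i).[z] /\ m' z i 1 = cauchy p s.+1 (f' i) z.
  by move=> zs; rewrite mE' // !mxE /f'; have [->|->] := ord2P i.
have mTf i j z : z \notin poles p s.+1 ->
    m' z i j = m z i j + (z - z0)^-1 * (T i 0 * m z 0 j + T i 1 * m z 1 j).
  move=> zs; rewrite mT // mulmxDl mul1mx -scalemxAl [LHS]mxE; congr (_ + _).
  by rewrite mxE mulmx2E.
have nears := near_notin (poles p s.+1) z0.
(* Row [i] of [T] applied to the polynomials [(P, Q)]. *)
pose hp i := T i 0 *: P + T i 1 *: Q.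
have TP i : (hp i).[z0] = 0.
  have H : \forall z \near z0^', (hp i).[z] = (z - z0) * ((f' i).[z] - (f i).[z]).
    apply: filterS2 nears (nbhs_dnbhs_neq z0) => z zs zz0.
    have zs' := notin_polesS zs.
    have := mTf i 0 z zs; have [-> _] := mf' i z zs; have [-> _] := mf i z zs'.
    have [-> _] := mf 0 z zs'; have [-> _] := mf 1 z zs'.
    move=> ->; rewrite !hornerE /f /=; have : z - z0 != 0 by rewrite subr_eq0.
    by move=> n; field.
  have r1 := rational_at_horner (hp i) z0.
  have r2 := rational_atM (rational_atB (rational_at_id z0) (rational_at_cst z0 z0))
    (rational_atB (rational_at_horner (f' i) z0) (rational_at_horner (f i) z0)).
  by rewrite (rational_at_eq r1 r2 H) /= subrr mul0r.
have fE i : (f' i).[z0] = (f i).[z0] + (hp i)^`().[z0].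
  have [g [gE _ gd]] := poly_quotient (hp i) z0.
  rewrite TP addr0 in gE; rewrite -gd.
  have H : \forall z \near z0^', (f' i).[z] = (f i).[z] + g.[z].
    apply: filterS2 nears (nbhs_dnbhs_neq z0) => z zs zz0.
    have zs' := notin_polesS zs.
    have := mTf i 0 z zs; have [-> _] := mf' i z zs; have [-> _] := mf i z zs'.
    have [-> _] := mf 0 z zs'; have [-> _] := mf 1 z zs'.
    have : (hp i).[z] = g.[z] * (z - z0) by rewrite gE hornerM hornerXsubC.
    rewrite /hp !hornerE /f /= => -> ->.
    by rewrite mulrC mulfK // subr_eq0.
  exact: (rational_at_eq (rational_at_horner _ z0)
    (rational_atD (rational_at_horner _ z0) (rational_at_horner _ z0)) H).
(* Residues of the second columns: the last term of the Cauchy transform in [m'] is the only one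
   singular at [z0]. *)
have TC i : T i 0 * cauchy p s P z0 + T i 1 * cauchy p s Q z0 = w s * (f' i).[z0].
  have H : \forall z \near z0^',
      T i 0 * cauchy p s P z + T i 1 * cauchy p s Q z =
      (z - z0) * (cauchy p s (f' i) z - cauchy p s (f i) z) + w s * (f' i).[z0].
    apply: filterS2 nears (nbhs_dnbhs_neq z0) => z zs zz0.
    have zs' := notin_polesS zs.
    have := mTf i 1 z zs; have [_ ->] := mf' i z zs; have [_ ->] := mf i z zs'.
    have [_ ->] := mf 0 z zs'; have [_ ->] := mf 1 z zs'.
    rewrite cauchyS /f /= -/z0; have : z - z0 != 0 by rewrite subr_eq0.
    move=> n E; rewrite (_ : cauchy p s (f' i) z = cauchy p s (f i) z +
      (z - z0)^-1 * (T i 0 * cauchy p s P z + T i 1 * cauchy p s Q z) -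
      w s * (f' i).[z0] / (z - z0)); last by rewrite -E addrK.
    by field.
  have rc g := rational_at_cauchy g (rational_at_id z0) z0s.
  have r1 := rational_atD (rational_atM (rational_at_cst (T i 0) z0) (rc P))
                          (rational_atM (rational_at_cst (T i 1) z0) (rc Q)).
  have r2 := rational_atD (rational_atM (rational_atB (rational_at_id z0)
     (rational_at_cst z0 z0)) (rational_atB (rc (f' i)) (rc (f i))))
     (rational_at_cst (w s * (f' i).[z0]) z0).
  by rewrite (rational_at_eq r1 r2 H) /= subrr mul0r add0r.
set M := m z0 in W *.
have uM : M \in unitmx by rewrite unitmxE (OP_det h z0s) unitr1.
(* [T] in the basis of the columns of [m] at the node. Its first column vanishes, so [U 1 1] is an
   eigenvalue, which nilpotency makes 0. *)
pose U := invmx M *m T *m M.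
have TM : T *m M = M *m U by rewrite /U !mulmxA mulmxV // mul1mx.
have ME : M = mx2 P.[z0] (cauchy p s P z0) Q.[z0] (cauchy p s Q z0) by rewrite /M mE.
have VE := OP_inv h z0s; rewrite -/M in VE.
have TM0 i : (T *m M) i 0 = 0.
  by rewrite mulmx2E ME !mxE /=; have := TP i; rewrite /hp !hornerE.
have U0 i : U i 0 = 0.
  by rewrite /U -mulmxA mulmx2E !TM0 !mulr0 addr0.
have U11 : U 1 1 = 0.
  have Uk n : U ^+ n = invmx M *m T ^+ n *m M.
    elim: n => [|n IH]; first by rewrite !expr0 mulmx1 mulVmx.
    rewrite !exprS IH -!mulmxE /U; move: (T ^+ n) => Tn.
    by rewrite !mulmxA (mulmxK uM).
  have U11k n : (U ^+ n) 1 1 = U 1 1 ^+ n.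
    elim: n => [|n IH]; first by rewrite !expr0 mxE.
    by rewrite exprS -mulmxE mulmx2E U0 mul0r add0r IH exprS.
  have : U 1 1 ^+ k = 0 by rewrite -U11k Uk Tk mulmx0 mul0mx mxE.
  by move/eqP; rewrite expf_eq0 => /andP[_ /eqP].
have UE : U = mx2 0 (U 0 1) 0 0 by apply: matrix2P; rewrite ?U0 ?U11 !mxE.
exists (U 0 1); split; last by rewrite TM {1}UE.
have MU1 i : (M *m U) i 1 = U 0 1 * (f i).[z0].
  by rewrite mulmx2E U11 mulr0 addr0 mulrC; have [-> _] := mf i z0 z0s.
have MU0 i : (M *m U) i 0 = 0 by rewrite -TM TM0.
have TE : T = M *m U *m invmx M by rewrite -TM mulmxK.
have T0 i : T i 0 = - (U 0 1 * (f i).[z0] * Q.[z0]).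
  by rewrite TE mulmx2E MU0 MU1 VE !mxE /= mul0r add0r mulrN.
have T1 i : T i 1 = U 0 1 * (f i).[z0] * P.[z0].
  by rewrite TE mulmx2E MU0 MU1 VE !mxE /= mul0r add0r.
have key i : (U 0 1 - w s * (1 + U 0 1 * kappa P Q z0)) * (f i).[z0] = 0.
  have := TC i; rewrite fE /hp derivD !derivZ !hornerE /=.
  have -> : T i 0 * cauchy p s P z0 + T i 1 * cauchy p s Q z0 = U 0 1 * (f i).[z0].
    by rewrite -MU1 -TM mulmx2E ME !mxE.
  rewrite T0 T1 /kappa => E; apply/eqP; rewrite mulrBl subr_eq0 E; apply/eqP.
  by ring.
(* The relation holds after multiplication by [P] and by [Q] at the node, and the Wronskian forbids
   both values to vanish. *)
set e := U 0 1 - _ in key.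
have e0 : e = 0.
  have k0 := key 0; have k1 := key 1; rewrite /f /= in k0 k1.
  rewrite -[e]mulr1 -W mulrBr !mulrA k0 k1 !mul0r subrr //.
apply/eqP; rewrite -subr_eq0 -[X in _ == X]e0 /e; apply/eqP.
by move: (U 0 1) (kappa P Q z0) => tau k0; ring.
Qed.

End Transfer.

(** * One step of the gap probability *)

Section GapRecursion.
Context {R : realType} (p : qRacah_param R).
Local Notation C := (Cx R).
Local Notation pi x := (toC (node p x)).
Local Notation w x := (toC (omega p x)).
Local Notation N := (rN p).
Hypotheses (piI : injective (node p)) (N0 : (0 < N)%N).

Lemma det_hankel_toC s : toC (\det (hankel N (omega p) (node p) s)) =
  \det (hankel N (fun x => w x) (fun x => pi x) s).
Proof.
rewrite -det_map_mx; congr (\det _); apply/matrixP => i j; rewrite !mxE rmorph_sum.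
by apply: eq_bigr => x _; rewrite rmorphM rmorphXn.
Qed.

Lemma OP_hankel_neq0 s m P Q : is_OP_solution p s m P Q ->
  \det (hankel N (omega p) (node p) s) != 0.
Proof.
move=> [[sP sQ] _ _ oP oQ].
set D := \det _; have <- : (toC D != 0) = (D != 0) by rewrite fmorph_eq0.
rewrite /D det_hankel_toC.
(* [node] is defined at every natural number, so the points from index [s] on give infinitely many
   values off the first [s] nodes. *)
apply: (@det_hankel_neq0 _ (fun x => w x) (fun x => pi x) N s P Q N0 sP sQ oP oQ
  (fun i => pi (s + i)%N)).
  by move=> i j /complexI/piI/addnI.
by move=> i x; apply: notin_poles_sub; apply: node_notin_poles => //; exact: leq_addr.
Qed.

Lemma gap_prob_step s m P Q : is_OP_solution p s m P Q -> (s <= rM p)%N ->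
  toC (gap_prob p s.+1) = toC (gap_prob p s) * (1 - w s * kappa P Q (pi s)).
Proof.
move=> [[sP sQ] _ _ oP oQ] sM.
rewrite !gap_probE ?ltnS // ?(leq_trans sM) // !fmorph_div /= mulrAC; congr (_ / _).
rewrite !det_hankel_toC.
apply: (@det_hankelS _ (fun x => w x) (fun x => pi x) N s P Q N0 sP sQ oP oQ) => x.
by apply: notin_poles_sub; exact: node_notin_poles.
Qed.

Lemma gap_prob_neq0 s m P Q m' P' Q' : is_OP_solution p s m P Q ->
  is_OP_solution p (rM p).+1 m' P' Q' -> (s <= (rM p).+1)%N -> toC (gap_prob p s) != 0.
Proof.
move=> h h' sM; rewrite fmorph_eq0 gap_probE // mulf_neq0 ?invr_eq0 //.
  exact: OP_hankel_neq0 h.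
exact: OP_hankel_neq0 h'.
Qed.

End GapRecursion.

(** * Nodes and first-order recursion of the q-Racah weight *)

Section QRacahWeight.
Context {R : realType} (p : qRacah_param R).
Local Notation C := (Cx R).
Local Notation q := (rq p).
Local Notation a := (ralpha p).
Local Notation b := (rbeta p).
Local Notation c := (rgamma p).
Local Notation d := (rdelta p).
Hypotheses (q_itv : 0 < q < 1) (gdq_itv : 0 < c * d * q < 1)
  (u2E : ru p ^+ 2 = c * d * q ^+ 2).

Lemma q_gt0 : 0 < q. Proof. by case/andP: q_itv. Qed.
Lemma q_neq0 : q != 0. Proof. by rewrite gt_eqF // q_gt0. Qed.

(** With X = q^x, Y = q^y and e = gamma delta q, equality of two nodes gives (Y - X)(1 - e X Y) = 0;
    the second factor is positive because e < 1 and X Y <= 1. *)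
Lemma node_injective : injective (node p).
Proof.
move=> x y; have q0 := q_gt0.
have qx0 : 0 < q ^+ x by rewrite exprn_gt0.
have qy0 : 0 < q ^+ y by rewrite exprn_gt0.
have nE z : node p z = (q ^+ z)^-1 + c * d * q * q ^+ z.
  rewrite /node /sigma u2E; have : q ^+ z != 0 by rewrite expf_neq0 // q_neq0.
  by have := q_neq0; move: (q ^+ z) => Z; move=> ? ?; field; apply/andP.
rewrite !nE => E.
have qx1 : q ^+ x <= 1 by rewrite exprn_ile1 // ltW //; case/andP: q_itv.
have qy1 : q ^+ y <= 1 by rewrite exprn_ile1 // ltW //; case/andP: q_itv.
have q1 : q != 1 by rewrite lt_eqF //; case/andP: q_itv.
apply: (ieexprIn q0 q1); move: E; case/andP: gdq_itv.
move: (q ^+ x) (q ^+ y) (c * d * q) qx0 qy0 qx1 qy1 => X Y e X0 Y0 X1 Y1 e0 e1 E.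
have XY : 0 < X * Y by rewrite mulr_gt0.
have XY1 : X * Y <= 1 by rewrite mulr_ile1 // ltW.
have : (Y - X) * (1 - e * (X * Y)) = 0.
  have : (X^-1 + e * X) * (X * Y) = (Y^-1 + e * Y) * (X * Y) by rewrite E.
  rewrite !mulrDl mulKf ?gt_eqF // [_^-1 * (X * Y)]mulrCA mulVf ?gt_eqF // mulr1.
  by move=> E'; apply/eqP; rewrite -(subr_eq0 _ 0) -{2}(subrr (Y + e * X * (X * Y))) {2}E'; apply/eqP; ring.
move/eqP; rewrite mulf_eq0 subr_eq0 => /orP[/eqP //|].
rewrite subr_eq0 => /eqP h; exfalso.
have : e * (X * Y) < 1 by rewrite (le_lt_trans _ e1) // ger_pMr.
by rewrite -h ltxx.
Qed.

Lemma sigma_node x : sigma (toC q) (toC (ru p)) (toC q ^- x) = toC (node p x).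
Proof.
by rewrite /node /sigma rmorphD fmorph_div rmorphM rmorphXn fmorphV rmorphXn.
Qed.

(* q^-x sigma'(q^-x), as u^2 = gamma delta q^2. *)
Definition sigma_slope (x : nat) : R := q ^- x - c * d * q * q ^+ x.

Lemma sigma_slope_neq0 x : sigma_slope x != 0.
Proof.
have q0 := q_gt0; have qx : 0 < q ^+ x by rewrite exprn_gt0.
have qx1 : q ^+ x <= 1 by rewrite exprn_ile1 // ltW //; case/andP: q_itv.
case/andP: gdq_itv => e0 e1; rewrite subr_eq0 gt_eqF //.
rewrite (lt_le_trans (y := 1)) //; last by rewrite invf_ge1.
by rewrite (le_lt_trans _ e1) // ger_pMr.
Qed.

(** Each new Pochhammer factor is q^x times a factor of [Phi_plus] or [Phi_minus]; the quadratic
    factor of the weight becomes the slope, whose extra q matches that of (alpha beta q)^x. *)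
Lemma Phi_omega x : a != 0 -> b != 0 -> omega p x.+1 != 0 ->
  [/\ Phi_plus p (toC q ^- x) != 0, Phi_minus p (toC q ^- x) != 0 &
    toC (omega p x.+1) * Phi_minus p (toC q ^- x) * toC (sigma_slope x) =
    toC (omega p x) * Phi_plus p (toC q ^- x) * toC (sigma_slope x.+1)].
Proof.
move=> a0 b0.
pose Pp := (q ^- x - a * q) * (q ^- x - b * d * q) * (q ^- x - c * q) * (q ^- x - c * d * q).
pose Pm := a * b * (q ^- x - a^-1 * c * d * q) * (q ^- x - b^-1 * c * q) * (q ^- x - d * q) * (q ^- x - q).
have -> : Phi_plus p (toC q ^- x) = toC Pp.
  by rewrite /Phi_plus /Pp !(rmorphM, rmorphB, fmorphV, rmorphXn).
have -> : Phi_minus p (toC q ^- x) = toC Pm.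
  by rewrite /Phi_minus /Pm !(rmorphM, rmorphB, fmorphV, rmorphXn).
rewrite -!rmorphM !fmorph_eq0 => o0.
suff [h1 h2 h3] : [/\ Pp != 0, Pm != 0 & omega p x.+1 * Pm * sigma_slope x = omega p x * Pp * sigma_slope x.+1].
  by split => //; rewrite h3.
have q0 := q_neq0.
have X0 : q ^+ x != 0 by rewrite expf_neq0.
have e1 : 1 - c * d * q ^+ x.*2.+1 != 0.
  have := sigma_slope_neq0 x; rewrite /sigma_slope -muln2 exprS exprM expr2.
  by apply: contraNneq => h; apply/eqP; apply: (mulIf X0); rewrite mul0r -h; field.
have qS y : qpoch q y x.+1 = qpoch q y x * (1 - y * q ^+ x) by rewrite /qpoch big_ord_recr.
have E1 : c * d * q ^+ x.*2.+1 = c * d * q * q ^+ x * q ^+ x.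
  by rewrite -muln2 exprS exprM expr2; ring.
have E3 : c * d * q ^+ x.+1.*2.+1 = c * d * q * q ^+ x * q ^+ x * q * q.
  by rewrite doubleS !exprS -muln2 exprM expr2; ring.
rewrite E1 in e1; move: o0; rewrite /omega /Pp /Pm /sigma_slope !qS E1 E3 !exprS.
move: (qpoch q (a * q) x) (qpoch q (b * d * q) x) (qpoch q (c * q) x) (qpoch q (c * d * q) x)
  (qpoch q q x) (qpoch q (a^-1 * c * d * q) x) (qpoch q (b^-1 * c * q) x) (qpoch q (d * q) x)
  ((a * b * q) ^+ x) => f1 f2 f3 f4 f5 f6 f7 f8 f9.
move: (q ^+ x) X0 e1 => X X0 e1.
(* A vanishing denominator would make the weight 0 by the convention x / 0 = 0, so the hypothesis
   excludes the zeros of numerator and denominator factors alike. *)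
rewrite !(mulf_eq0, invr_eq0, negb_or) -!andbA.
case/and5P=> n1 m1 n2 m2 /and5P[n3 m3 n4 m4] /and5P[n5 m5 n6 m6] /and5P[n7 m7 n8 m8] /and5P[l1 l2 l3 l4 /andP[l5 _]].
have k1 y : X^-1 - y = (1 - y * X) / X by field.
split.
- by rewrite !k1 !(mulf_eq0, invr_eq0, negb_or) m1 m2 m3 m4 X0.
- by rewrite !k1 !(mulf_eq0, invr_eq0, negb_or) a0 b0 m5 m6 m7 m8 X0.
have cdq : 1 - c * d * q != 0 by rewrite subr_eq0 gt_eqF //; case/andP: gdq_itv.
have k2 : X^-1 - c * d * q * X = (1 - c * d * q * X * X) / X by field.
have k3 : (q * X)^-1 - c * d * q * (q * X) =
    (1 - c * d * q * X * X * q * q) / (q * X) by field; rewrite X0 q0.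
rewrite k2 k3 !k1; clear -n1 n2 n3 n4 n5 n6 n7 n8 m1 m2 m3 m4 m5 m6 m7 m8 l1 l2 l3 l4 l5 a0 b0 q0 X0 e1 cdq.
move: m1 m2 m3 m4 m5 m6 m7 m8 e1 cdq.
move: (1 - a * q * X) (1 - b * d * q * X) (1 - c * q * X) (1 - c * d * q * X)
  (1 - q * X) (1 - a^-1 * c * d * q * X) (1 - b^-1 * c * q * X) (1 - d * q * X)
  (1 - c * d * q * X * X) (1 - c * d * q * X * X * q * q) (1 - c * d * q)
  => g1 g2 g3 g4 g5 g6 g7 g8 g9 g10 g11 *.
by field; do !(apply/andP; split).
Qed.

End QRacahWeight.

(** * The Lax matrix: its residue and the derivative of the inverse product *)

Section LaxMatrices.
Context {R : realType} (p : qRacah_param R).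
Local Notation C := (Cx R).
Local Notation pi x := (toC (node p x)).
Local Notation w x := (toC (omega p x)).
Local Notation N := (rN p).
Local Notation q := (toC (rq p)).
Local Notation u := (toC (ru p)).
Local Notation sig := (sigma q u).
Hypotheses (piI : injective (node p)) (N0 : (0 < N)%N) (q0 : q != 0).
Hypothesis sigE : forall x, sig (q ^- x) = pi x.

Let phi z := Phi_plus p z / Phi_minus p z.

Lemma rational_at_sigma f z : rational_at f z -> f z != 0 ->
  rational_at (fun y => sig (f y)) z.
Proof.
move=> hf f0; have hq := rational_atM (rational_at_cst q z) hf.
have qf : q * f z != 0 by rewrite mulf_neq0.
exact: rational_atD hf (rational_atM (rational_at_cst (u ^+ 2) z) (rational_atV hq qf)).
Qed.

Lemma rational_at_Phi_plus z : rational_at (Phi_plus p) z.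
Proof.
have h c := rational_atB (rational_at_id z) (rational_at_cst c z).
exact: rational_atM (rational_atM (rational_atM (h _) (h _)) (h _)) (h _).
Qed.

Lemma rational_at_Phi_minus z : rational_at (Phi_minus p) z.
Proof.
have h c := rational_atB (rational_at_id z) (rational_at_cst c z).
exact: rational_atM (rational_atM (rational_atM (rational_atM (rational_at_cst _ z)
  (h _)) (h _)) (h _)) (h _).
Qed.

Lemma rational_at_phi z : Phi_minus p z != 0 -> rational_at phi z.
Proof.
move=> h; exact: rational_atM (rational_at_Phi_plus z) (rational_atV (rational_at_Phi_minus z) h).
Qed.

(** The second factor is the divided difference of [sigma], equal to sigma'(z) at [y = z]. *)
Lemma sigma_sub y z : y != 0 -> z != 0 ->
  sig y - sig z = (y - z) * (1 - u ^+ 2 / (q * y * z)).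
Proof. by move=> y0 z0; rewrite /sigma; field; rewrite q0 y0 z0. Qed.

Lemma AmxE s m P Q y i : is_OP_solution p s m P Q -> sig y \notin poles p s ->
  Amx p m y i 0 = m (sig (q^-1 * y)) i 0 * phi y * cauchy p s Q (sig y)
                  - m (sig (q^-1 * y)) i 1 * Q.[sig y] /\
  Amx p m y i 1 = m (sig (q^-1 * y)) i 1 * P.[sig y]
                  - m (sig (q^-1 * y)) i 0 * phi y * cauchy p s P (sig y).
Proof.
move=> h ys; rewrite /Amx (OP_inv N0 h ys) !mulmx2E !mxE /= -/(phi y).
by split; ring.
Qed.

Lemma qV_expr n : q^-1 * q ^- n = q ^- n.+1.
Proof. by rewrite exprS invfM. Qed.

(** At [q^-t] the left factor of [Amx] is evaluated near the node [t.+1], where it is regular, and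
    the inverse on the right near the last node [t], where only the Cauchy transforms are singular.
    The residue is the column [(P, Q)] at node [t.+1] times the row [(Q, -P)] at node [t], hence of
    rank one. *)
Lemma Amx_simple_pole t m P Q :
  is_OP_solution p t.+1 m P Q ->
  Phi_plus p (q ^- t) != 0 -> Phi_minus p (q ^- t) != 0 ->
  1 - u ^+ 2 / (q * q ^- t * q ^- t) != 0 ->
  exists k, k != 0 /\ simple_pole (Amx p m) (q ^- t)
    (mx2 (k * P.[pi t.+1] * Q.[pi t]) (- (k * P.[pi t.+1] * P.[pi t]))
         (k * Q.[pi t.+1] * Q.[pi t]) (- (k * Q.[pi t.+1] * P.[pi t]))).
Proof.
move=> h; set z0 := q ^- t => php phm s1n.
have z00 : z0 != 0 by rewrite invr_eq0 expf_neq0.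
have qz0 : q^-1 * z0 != 0 by rewrite mulf_neq0 // invr_eq0.
have [_ mE wn _ _] := h.
have sz0 : sig z0 = pi t by exact: sigE.
have sy0 : sig (q^-1 * z0) = pi t.+1 by rewrite qV_expr sigE.
pose s1 y := 1 - u ^+ 2 / (q * y * z0).
have hid := rational_at_id z0; have hc c := rational_at_cst c z0.
have rs1 : rational_at s1 z0.
  have h1 := rational_atM (rational_atM (hc q) hid) (hc z0).
  have h10 : q * z0 * z0 != 0 by rewrite !mulf_neq0.
  exact: rational_atB (hc 1) (rational_atM (hc (u ^+ 2)) (rational_atV h1 h10)).
have rsig := rational_at_sigma hid z00.
have rsigq := rational_at_sigma (rational_atM (hc q^-1) hid) qz0.
have off0 : sig z0 \notin poles p t by rewrite sz0; exact: node_notin_poles.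
have off1 : sig (q^-1 * z0) \notin poles p t.+1.
  by rewrite sy0; exact: node_notin_poles.
pose f (i : 'I_2) := if i == 0 then P else Q.
have [wt0 abn] := wn t (ltnSn t).
pose Y0 i y := (f i).[sig (q^-1 * y)].
pose Y1 i y := cauchy p t.+1 (f i) (sig (q^-1 * y)).
have rY0 i : rational_at (Y0 i) z0 by exact: rational_at_comp_horner.
have rY1 i : rational_at (Y1 i) z0 by exact: rational_at_cauchy.
have rphi := rational_at_phi phm.
have rC g : rational_at (fun y => cauchy p t g (sig y)) z0 by exact: rational_at_cauchy.
have rH (g : {poly C}) : rational_at (fun y => g.[sig y]) z0 by exact: rational_at_comp_horner.
have nY : \forall y \near z0, sig (q^-1 * y) \notin poles p t.+1.
  exact: continuous_near_notin (rational_at_continuous rsigq) off1.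
have nX : \forall y \near z0, sig y \notin poles p t.
  exact: continuous_near_notin (rational_at_continuous rsig) off0.
have nS : \forall y \near z0, s1 y != 0.
  exact: continuous_near_neq0 (rational_at_continuous rs1) s1n.
have n0 : \forall y \near z0, y != 0.
  exact: continuous_near_neq0 (rational_at_continuous hid) z00.
pose F0 i y := (y - z0)^-1 * (Y0 i y * phi y * (w t * Q.[pi t]) * (s1 y)^-1)
    + (Y0 i y * phi y * cauchy p t Q (sig y) - Y1 i y * Q.[sig y]).
pose F1 i y := (y - z0)^-1 * (Y0 i y * phi y * (- (w t * P.[pi t])) * (s1 y)^-1)
    + (Y1 i y * P.[sig y] - Y0 i y * phi y * cauchy p t P (sig y)).
have nA : \forall y \near z0, y != z0 -> forall i,
  Amx p m y i 0 = F0 i y /\ Amx p m y i 1 = F1 i y.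
  have nn : \forall y \near z0, s1 y != 0 /\ y != 0 by exact: filterI nS n0.
  apply: filterS3 nY nX nn => y yY yX [s1y y0] yz i.
  have dE : sig y - pi t = (y - z0) * s1 y by rewrite -sz0 sigma_sub.
  have yz0 : y - z0 != 0 by rewrite subr_eq0.
  have yS : sig y \notin poles p t.+1.
    apply/polesP => -[x]; rewrite ltnS leq_eqVlt => /orP[/eqP ->|xt] E.
      by move/eqP: dE; rewrite E subrr eq_sym mulf_eq0 (negbTE yz0) (negbTE s1y).
    by case/polesP: yX; exists x.
  have mi : m (sig (q^-1 * y)) i 0 = Y0 i y /\ m (sig (q^-1 * y)) i 1 = Y1 i y.
    by rewrite mE // !mxE /Y0 /Y1 /f; have [->|->] := ord2P i.
  have [-> ->] := AmxE i h yS; have [-> ->] := mi.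
  rewrite !cauchyS dE /F0 /F1; move: (phi y) => ph; split; field; rewrite ?s1y ?yz0 //.
have rs1V := rational_atV rs1 s1n.
have H (i j : 'I_2) : exists2 G, analytic_at G z0 & \forall y \near z0^',
   Amx p m y i j = (y - z0)^-1 * (Y0 i z0 * phi z0 *
     (if j == 0 then w t * Q.[pi t] else - (w t * P.[pi t])) * (s1 z0)^-1) + G y.
  have hh c := rational_atM (rational_atM (rational_atM (rY0 i) rphi) (hc c)) rs1V.
  have hg0 := rational_atB (rational_atM (rational_atM (rY0 i) rphi) (rC Q))
     (rational_atM (rY1 i) (rH Q)).
  have hg1 := rational_atB (rational_atM (rY1 i) (rH P))
     (rational_atM (rational_atM (rY0 i) rphi) (rC P)).
  have [->|->] := ord2P j.
    apply: (rational_at_pole (hh _) hg0).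
    suff nA' : \forall y \near z0, y != z0 -> Amx p m y i 0 = F0 i y by exact: nA'.
    by apply: filterS nA => y hy yz; exact: (proj1 (hy yz i)).
  apply: (rational_at_pole (hh _) hg1).
  suff nA' : \forall y \near z0, y != z0 -> Amx p m y i 1 = F1 i y by exact: nA'.
  by apply: filterS nA => y hy yz; exact: (proj2 (hy yz i)).
have k0 : phi z0 * w t / s1 z0 != 0.
  have ph0 : phi z0 != 0 by rewrite /phi mulf_neq0 // invr_eq0.
  have s10 : s1 z0 != 0 by exact: s1n.
  exact: mulf_neq0 (mulf_neq0 ph0 wt0) (invr_neq0 s10).
(* [s1 z0] is sigma'(z0), which converts a residue in sigma(z) into one in [z]. The residue is
   nonzero: the Wronskian excludes a zero column, and the pole of [m] at node [t] excludes a zero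
   row. *)
exists (phi z0 * w t / s1 z0); split => //; split.
  apply/eqP => /matrixP E.
  have := OP_wronskian N0 h (node_notin_poles piI (leqnn t.+1)).
  move: (phi z0 * w t / s1 z0) k0 E => k k0 E.
  have E2 (x y z : C) : x != 0 -> x * y * z = 0 -> z != 0 -> y = 0.
    by move=> x0 /eqP; rewrite !mulf_eq0 (negbTE x0) => /orP[/eqP|/eqP ->] //; rewrite eqxx.
  have := E 1 1; have := E 1 0; have := E 0 1; have := E 0 0; rewrite !mxE /=.
  move=> e00 /eqP; rewrite oppr_eq0 => /eqP e01 e10 /eqP; rewrite oppr_eq0 => /eqP e11.
  case: abn => n.
    rewrite (E2 _ _ _ k0 e01 n) (E2 _ _ _ k0 e11 n) !mul0r subrr.
    by move=> /esym/eqP; rewrite oner_eq0.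
  rewrite (E2 _ _ _ k0 e00 n) (E2 _ _ _ k0 e10 n) !mul0r subrr.
  by move=> /esym/eqP; rewrite oner_eq0.
pose G i j := s2val (cid2 (H i j)).
exists (fun y => \matrix_(i, j) G i j y).
  move=> i j; have hG : analytic_at (G i j) z0 := s2valP (cid2 (H i j)).
  by apply: analytic_at_near hG; apply: filterE => y; rewrite mxE.
have HG i j := s2valP' (cid2 (H i j)).
have HG' : \forall y \near z0^', forall i j, Amx p m y i j = (y - z0)^-1 * (Y0 i z0 * phi z0 *
     (if j == 0 then w t * Q.[pi t] else - (w t * P.[pi t])) * (s1 z0)^-1) + G i j y.
  by apply: filter_forall => i; apply: filter_forall => j; exact: HG.
apply: filterS HG' => y hy; apply/matrixP => i j; rewrite hy !mxE /Y0 sy0 /f.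
by congr (_ + _); have [->|->] := ord2P i; have [->|->] := ord2P j; rewrite /=; ring.
Qed.

(* On the left is det [p_s, ((R_s A_s)^-1)' p_(s+1)] at q^-s, where p_s is the
   first column of m_s(pi_s). *)
Lemma det2_derivative s m m' P Q P' Q' T (z0 := q ^- s) :
  is_OP_solution p s m P Q -> is_OP_solution p s.+1 m' P' Q' ->
  (forall z, z \notin poles p s.+1 -> m' z = (1 + (z - pi s)^-1 *: T) *m m z) ->
  Phi_plus p z0 != 0 -> Phi_minus p z0 != 0 ->
  det2 (cvec2 P.[pi s] Q.[pi s])
    ('D_1 (fun z => invmx (Amx p m z) *m invmx (Rmx p s T (q^-1 * z))) z0
       *m cvec2 P'.[pi s.+1] Q'.[pi s.+1]) =
  (1 - u ^+ 2 / (q * z0 * z0)) * kappa P Q (pi s) / (Phi_plus p z0 / Phi_minus p z0)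
  - q^-1 * (1 - u ^+ 2 * q / (z0 * z0)) * kappa P' Q' (pi s.+1).
Proof.
move=> h h' mT php phm.
have z00 : z0 != 0 by rewrite invr_eq0 expf_neq0.
have qz0 : q^-1 * z0 != 0 by rewrite mulf_neq0 // invr_eq0.
have [_ mE _ _ _] := h.
have sz0 : sig z0 = pi s by exact: sigE.
have sy0 : sig (q^-1 * z0) = pi s.+1 by rewrite qV_expr sigE.
have hid := rational_at_id z0; have hc c := rational_at_cst c z0.
have rsig := rational_at_sigma hid z00.
have rsigq := rational_at_sigma (rational_atM (hc q^-1) hid) qz0.
have off0 : sig z0 \notin poles p s by rewrite sz0; exact: node_notin_poles.
have off1 : sig (q^-1 * z0) \notin poles p s.+1.
  by rewrite sy0; exact: node_notin_poles.
have ph0 : phi z0 != 0 by rewrite /phi mulf_neq0 // invr_eq0.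
have rphi := rational_at_phi phm.
have rphiV := rational_atV rphi ph0.
have nX : \forall y \near z0, sig y \notin poles p s.
  exact: continuous_near_notin (rational_at_continuous rsig) off0.
have nY : \forall y \near z0, sig (q^-1 * y) \notin poles p s.+1.
  exact: continuous_near_notin (rational_at_continuous rsigq) off1.
have nphi : \forall y \near z0, phi y != 0.
  exact: continuous_near_neq0 (rational_at_continuous rphi) ph0.
pose f (i : 'I_2) := if i == 0 then P else Q.
pose V0 (j : 'I_2) y := if j == 0 then cauchy p s.+1 Q' (sig (q^-1 * y))
  else - cauchy p s.+1 P' (sig (q^-1 * y)).
pose V1 (j : 'I_2) y := if j == 0 then - Q'.[sig (q^-1 * y)] else P'.[sig (q^-1 * y)].
pose G (i j : 'I_2) y := (f i).[sig y] * (phi y)^-1 * V0 j y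
  + cauchy p s (f i) (sig y) * V1 j y.
pose F z := invmx (Amx p m z) *m invmx (Rmx p s T (q^-1 * z)).
have FE : \forall y \near z0, forall i j, F y i j = G i j y.
  apply: filterS3 nX nY nphi => y yX yY py.
  have yY' := notin_polesS yY.
  have RE : Rmx p s T (q^-1 * y) *m m (sig (q^-1 * y)) = m' (sig (q^-1 * y)).
    by rewrite mT // /Rmx sigE.
  have dm := OP_det N0 h yX.
  have dmq := OP_det N0 h yY'.
  have dm' := OP_det N0 h' yY.
  have unitE (A : 'M[C]_2) : \det A = 1 -> A \in unitmx by move=> d; rewrite unitmxE d unitr1.
  (* [R_s] turns [m] into [m'], so the inner factors cancel and what remains is regular at [z0]. *)
  have FI : F y = m (sig y) *m mx2 (phi y)^-1 0 0 1 *m invmx (m' (sig (q^-1 * y))).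
    have uR : Rmx p s T (q^-1 * y) \in unitmx.
      rewrite unitmxE; have := congr1 determinant RE.
      by rewrite det_mulmx dmq mulr1 dm' => ->; rewrite unitr1.
    have RV : invmx (Rmx p s T (q^-1 * y)) = m (sig (q^-1 * y)) *m invmx (m' (sig (q^-1 * y))).
      by apply: invmx_unique; rewrite mulmxA RE mulmxV // unitE.
    have AV : invmx (Amx p m y) = m (sig y) *m mx2 (phi y)^-1 0 0 1 *m invmx (m (sig (q^-1 * y))).
      apply: invmx_unique; rewrite /Amx -/(phi y).
      have DD : mx2 (phi y) 0 0 1 *m mx2 (phi y)^-1 0 0 1 = 1 :> 'M[C]_2.
        by apply: matrix2P; rewrite mulmx2E !mxE /= ?mulfV //; ring.
      rewrite -!mulmxA (mulmxA (invmx _)) mulVmx ?unitE // mul1mx.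
      by rewrite (mulmxA (mx2 (phi y) 0 0 1)) DD mul1mx mulmxV // unitE.
    rewrite /F AV RV -!mulmxA; congr (_ *m (_ *m _)).
    by rewrite mulmxA mulVmx ?mul1mx // unitE.
  move=> i j; rewrite FI (OP_inv N0 h' yY) !mulmx2E mE // !mxE /G /f /V0 /V1.
  by have [->|->] := ord2P i; have [->|->] := ord2P j; rewrite /=; ring.
have rf (i : 'I_2) : rational_at (fun y => (f i).[sig y]) z0.
  exact: rational_at_comp_horner.
have rcf (i : 'I_2) : rational_at (fun y => cauchy p s (f i) (sig y)) z0.
  exact: rational_at_cauchy.
have rP' (g : {poly C}) : rational_at (fun y => g.[sig (q^-1 * y)]) z0.
  exact: rational_at_comp_horner.
have rcP' g : rational_at (fun y => cauchy p s.+1 g (sig (q^-1 * y))) z0.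
  exact: rational_at_cauchy.
have rV0 j : rational_at (V0 j) z0.
  rewrite /V0; have [->|->] := ord2P j; rewrite /=; first exact: rcP'.
  exact: rational_atN (rcP' _).
have rV1 j : rational_at (V1 j) z0.
  rewrite /V1; have [->|->] := ord2P j; rewrite /=; last exact: rP'.
  exact: rational_atN (rP' _).
have rG i j : rational_at (G i j) z0.
  exact: rational_atD (rational_atM (rational_atM (rf i) rphiV) (rV0 j))
    (rational_atM (rcf i) (rV1 j)).
pose G1 i j := s2val (cid2 (rational_at_quotient (rG i j))).
have rG1 i j : rational_at (G1 i j) z0 := s2valP (cid2 (rational_at_quotient (rG i j))).
have G1E i j : \forall y \near z0, G i j y = G i j z0 + (y - z0) * G1 i j y
  := s2valP' (cid2 (rational_at_quotient (rG i j))).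
have FEij i j : \forall y \near z0, F y i j = G i j y by apply: filterS FE.
pose GM y : 'M[C]_2 := \matrix_(i, j) G1 i j y.
have DE : 'D_1 F z0 = GM z0.
  apply: derive1_mx_rational => i j.
    by apply: rational_at_ext (rG1 i j) => y; rewrite mxE.
  apply: filterS2 (FEij i j) (G1E i j) => y -> ->.
  by rewrite (nbhs_singleton (FEij i j)) mxE.
rewrite -/F DE.
set P0 := P.[pi s]; set Q0 := Q.[pi s]; set P1 := P'.[pi s.+1]; set Q1 := Q'.[pi s.+1].
(* Both polynomials vanish at their node; their quotients take there the values [kappa P Q] and
   [kappa P' Q']. *)
pose hA := P0 *: Q - Q0 *: P; pose hB := P1 *: Q' - Q1 *: P'.
have [A [AE _ Ad]] := poly_quotient hA (pi s).
have [B [BE _ Bd]] := poly_quotient hB (pi s.+1).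
have hA0 : hA.[pi s] = 0 by rewrite /hA hornerD hornerN !hornerZ -/P0 -/Q0 mulrC subrr.
have hB0 : hB.[pi s.+1] = 0 by rewrite /hB hornerD hornerN !hornerZ -/P1 -/Q1 mulrC subrr.
have {Ad}Ad : A.[pi s] = kappa P Q (pi s).
  by rewrite Ad /hA derivB !derivZ !hornerE.
have {Bd}Bd : B.[pi s.+1] = kappa P' Q' (pi s.+1).
  by rewrite Bd /hB derivB !derivZ !hornerE.
have AEx x : P0 * Q.[x] - Q0 * P.[x] = A.[x] * (x - pi s).
  by have := congr1 (horner^~ x) AE; rewrite /= hA0 !hornerE.
have BEx x : P1 * Q'.[x] - Q1 * P'.[x] = B.[x] * (x - pi s.+1).
  by have := congr1 (horner^~ x) BE; rewrite /= hB0 !hornerE.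
pose comb (H : 'I_2 -> 'I_2 -> C) :=
  P0 * (H 1 0 * P1 + H 1 1 * Q1) - Q0 * (H 0 0 * P1 + H 0 1 * Q1).
have combE y : det2 (cvec2 P0 Q0) (GM y *m cvec2 P1 Q1) = comb (fun i j => G1 i j y).
  by rewrite det2E !mulmx2E !mxE.
rewrite combE.
pose x1 y := V0 0 y * P1 + V0 1 y * Q1.
pose W y := P0 * cauchy p s Q (sig y) - Q0 * cauchy p s P (sig y).
pose s1 y := 1 - u ^+ 2 / (q * y * z0).
pose s2 y := q^-1 * (1 - u ^+ 2 * q / (y * z0)).
pose rhs y := x1 y * (phi y)^-1 * s1 y * A.[sig y] - s2 y * B.[sig (q^-1 * y)] * W y.
(* The contraction vanishes at [z0] term by term, each term carrying an explicit factor
   [sig y - pi s] or its shifted analogue; dividing by [y - z0] gives [rhs], and the derivative is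
   its value at [z0]. *)
have combG y : comb (fun i j => G i j y) =
    x1 y * (phi y)^-1 * (A.[sig y] * (sig y - pi s))
    - B.[sig (q^-1 * y)] * (sig (q^-1 * y) - pi s.+1) * W y.
  rewrite -AEx -BEx /comb /G /x1 /W /f /V1 /=; move: (V0 0 y) (V0 1 y) (phi y)^-1.
  by move=> a1 a2 a3; ring.
have rcomb : rational_at (fun y => comb (fun i j => G1 i j y)) z0.
  have r2 i := rational_atD (rational_atM (rG1 i 0) (hc P1)) (rational_atM (rG1 i 1) (hc Q1)).
  exact: rational_atB (rational_atM (hc P0) (r2 1)) (rational_atM (hc Q0) (r2 0)).
have rrhs : rational_at rhs z0.
  have rx1 := rational_atD (rational_atM (rV0 0) (hc P1)) (rational_atM (rV0 1) (hc Q1)).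
  have rW := rational_atB (rational_atM (hc P0) (rcf 1)) (rational_atM (hc Q0) (rcf 0)).
  have d1 : q * z0 * z0 != 0 by rewrite !mulf_neq0.
  have d2 : z0 * z0 != 0 by rewrite mulf_neq0.
  have rs1 := rational_atB (hc 1) (rational_atM (hc (u ^+ 2))
    (rational_atV (rational_atM (rational_atM (hc q) hid) (hc z0)) d1)).
  have rs2 := rational_atM (hc q^-1) (rational_atB (hc 1) (rational_atM (hc (u ^+ 2 * q))
    (rational_atV (rational_atM hid (hc z0)) d2))).
  have rA : rational_at (fun y => A.[sig y]) z0 by exact: rational_at_comp_horner.
  exact: rational_atB (rational_atM (rational_atM (rational_atM rx1 rphiV) rs1) rA)
    (rational_atM (rational_atM rs2 (rP' B)) rW).
have combG1 : \forall y \near z0, comb (fun i j => G i j y) =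
    comb (fun i j => G i j z0) + (y - z0) * comb (fun i j => G1 i j y).
  have H i : \forall y \near z0, G i 0 y = G i 0 z0 + (y - z0) * G1 i 0 y /\
      G i 1 y = G i 1 z0 + (y - z0) * G1 i 1 y.
    exact: filterI (G1E i 0) (G1E i 1).
  apply: filterS2 (H 0) (H 1) => y [e00 e01] [e10 e11].
  by rewrite /comb e00 e01 e10 e11; ring.
have comb0 : comb (fun i j => G i j z0) = 0.
  by rewrite combG sz0 sy0 !subrr !mulr0 mul0r subrr.
have n0 : \forall y \near z0, y != 0.
  exact: continuous_near_neq0 (rational_at_continuous hid) z00.
have H : \forall y \near z0^', comb (fun i j => G1 i j y) = rhs y.
  suff H' : \forall y \near z0, y != z0 -> comb (fun i j => G1 i j y) = rhs y by exact: H'.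
  apply: filterS2 combG1 n0 => y; rewrite comb0 add0r combG -sz0 -sy0 => E y0 yz.
  have yz0 : y - z0 != 0 by rewrite subr_eq0.
  have qy0 : q^-1 * y != 0 by rewrite mulf_neq0 // invr_eq0.
  have eA : sig y - sig z0 = (y - z0) * s1 y by rewrite sigma_sub.
  have eB : sig (q^-1 * y) - sig (q^-1 * z0) = (y - z0) * s2 y.
    by rewrite sigma_sub // /s2; field; rewrite q0 y0 z00.
  apply: (mulfI yz0); rewrite -E eA eB /rhs.
  by move: (x1 y) (phi y)^-1 (s1 y) (s2 y) (W y) => *; ring.
rewrite (rational_at_eq rcomb rrhs H) /rhs sz0 sy0 Ad Bd.
have -> : W z0 = 1 by rewrite /W sz0; apply: (OP_wronskian N0 h); rewrite -sz0.
have -> : x1 z0 = 1.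
  rewrite /x1 /V0 /= sy0; have := OP_wronskian N0 h' (node_notin_poles piI (leqnn s.+1)).
  by move=> <-; rewrite -/P1 -/Q1; ring.
rewrite /s1 /s2 -/(phi z0) mul1r mulr1; congr (_ - _).
by rewrite -mulrA mulrC.
Qed.

End LaxMatrices.

(** * The slope of sigma in the forms that occur *)

Section Slopes.
Context {R : realType} (p : qRacah_param R).
Local Notation q := (toC (rq p)).
Local Notation u := (toC (ru p)).
Hypotheses (q0 : rq p != 0) (u2E : ru p ^+ 2 = rgamma p * rdelta p * rq p ^+ 2).

Let u2C : u ^+ 2 = toC (rgamma p * rdelta p) * q ^+ 2.
Proof. by rewrite -rmorphXn u2E rmorphM rmorphXn. Qed.

Let slopeC x : toC (sigma_slope p x) =
  q ^- x - toC (rgamma p * rdelta p) * q * q ^+ x.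
Proof.
rewrite /sigma_slope rmorphB fmorphV rmorphXn; congr (_ - _).
by rewrite rmorphM rmorphXn; congr (_ * _); rewrite rmorphM.
Qed.

Let qC : q != 0. Proof. by rewrite fmorph_eq0. Qed.

Lemma sigma_slopeE x : toC (sigma_slope p x) =
  q ^- x * (1 - u ^+ 2 / (q * q ^- x * q ^- x)).
Proof.
have qx : q ^+ x != 0 by rewrite expf_neq0.
by rewrite slopeC u2C; move: (q ^+ x) qx => X X0; field; rewrite X0 qC.
Qed.

Lemma sigma_slopeS x : toC (sigma_slope p x.+1) = q ^- x.+1 - u ^+ 2 * q ^+ x.
Proof. by rewrite slopeC u2C [q ^+ x.+1]exprS; congr (_ - _); ring. Qed.

(** By the chain rule the slope at q^-(x+1) is also [z] times the derivative of sigma(z / q) at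
    [z = q^-x]. *)
Lemma sigma_slopeS_scaled x : toC (sigma_slope p x.+1) =
  q ^- x * (q^-1 * (1 - u ^+ 2 * q / (q ^- x * q ^- x))).
Proof.
have qx : q ^+ x != 0 by rewrite expf_neq0.
rewrite sigma_slopeS exprS; move: (q ^+ x) qx => X X0; field.
by rewrite X0 qC.
Qed.

End Slopes.

(** * Assembly of the recursion *)

Lemma det2_linear_r (R : realType) (x y z : 'cV[Cx R]_2) k l :
  det2 x (k *: y + l *: z) = k * det2 x y + l * det2 x z.
Proof. by rewrite !det2E !mxE; ring. Qed.

Lemma det2Z (R : realType) (x y : 'cV[Cx R]_2) k l :
  det2 (k *: x) (l *: y) = k * l * det2 x y.
Proof. by rewrite !det2E !mxE; ring. Qed.

Theorem proposition5p0p2 (R : realType) (p : qRacah_param R)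
  (q_itv : 0 < rq p < 1)
  (NM : (1 <= rN p <= rM p)%N)
  (alpha_gt0 : 0 < ralpha p) (beta_gt0 : 0 < rbeta p)
  (delta_ge0 : 0 <= rdelta p)
  (gammaE : rgamma p = rq p ^- (rM p).+1)
  (betadelta_lt1 : rbeta p * rdelta p < 1)
  (beta_ge : rgamma p <= rbeta p) (alpha_ge : rgamma p <= ralpha p)
  (gdq_itv : 0 < rgamma p * rdelta p * rq p < 1)
  (u_gt0 : 0 < ru p)
  (u2E : ru p ^+ 2 = rgamma p * rdelta p * rq p ^+ 2)
  (m : nat -> Cx R -> 'M[Cx R]_2)
  (m_DRHP : forall s, (rN p <= s <= (rM p).+1)%N -> solves_DRHP p s (m s))
  (T : nat -> 'M[Cx R]_2)
  (T_nilp : forall s, (rN p <= s <= rM p)%N -> exists k : nat, T s ^+ k = 0)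
  (mT : forall s, (rN p <= s <= rM p)%N -> forall z, z \notin poles p s.+1 ->
     m s.+1 z = (1 + (z - toC (node p s))^-1 *: T s) *m m s z)
  (T11_neq0 : forall s, (rN p <= s <= rM p)%N -> T s 0 0 != 0)
  (s : nat) (hs : (rN p <= s <= (rM p).-1)%N) :
  (exists2 r : 'M[Cx R]_2,
      simple_pole (Amx p (m s)) (toC (rq p) ^- s.-1) r &
      forall w : 'cV[Cx R]_2,
        T s *m w = 0 <-> exists y : 'cV[Cx R]_2, w = r *m y)
  /\
  forall v v2 : 'cV[Cx R]_2, v != 0 -> T s *m v = 0 -> T s *m v2 = v ->
    toC (gap_prob p s.+2 * gap_prob p s / gap_prob p s.+1 ^+ 2)
    = toC (omega p s.+1 / omega p s)
      * (Phi_minus p (toC (rq p) ^- s) / Phi_plus p (toC (rq p) ^- s)) ^+ 2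
      * (det2 (v_hat p s (m s) (T s) v) (v2_hat p s (m s) (T s) v v2)
         / det2 v v2).
Proof.
have piI := node_injective q_itv gdq_itv u2E.
have N0 : (0 < rN p)%N by case/andP: NM.
have qR0 := q_neq0 q_itv.
have q0 : toC (rq p) != 0 by rewrite fmorph_eq0.
have sigE := sigma_node p.
have [hNs hsM] := andP hs.
have M0 : (0 < rM p)%N by case/andP: NM => N1 NM'; exact: leq_trans NM'.
have sM : (s < rM p)%N by rewrite -(prednK M0) ltnS.
have OP x : (rN p <= x <= (rM p).+1)%N -> exists P Q, is_OP_solution p x (m x) P Q.
  by move=> hx; exact: DRHP_structure piI N0 (m_DRHP x hx).
have [|P [Q h]] := OP s; first by rewrite hNs leqW // ltnW.
have [|P' [Q' h']] := OP s.+1; first by rewrite leqW //= ltnS ltnW.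
have [|PM [QM hM]] := OP (rM p).+1; first by rewrite leqnn andbT leqW //; case/andP: NM.
(* Solvability at [M + 1] puts a genuine pole at every node up to [M]. *)
have om x : (x <= rM p)%N -> omega p x != 0.
  move=> xM; have [_ _ wn _ _] := hM; have [] := wn x; first by rewrite ltnS.
  by rewrite fmorph_eq0.
have a0 : ralpha p != 0 by rewrite gt_eqF.
have b0 : rbeta p != 0 by rewrite gt_eqF.
have Ph x : (x < rM p)%N -> _ := fun xM => Phi_omega q_itv gdq_itv a0 b0 (om x.+1 xM).
have mTs := mT s; rewrite hNs (ltnW sM) in mTs; have {}mTs := mTs isT.
have Tn := T_nilp s; rewrite hNs (ltnW sM) in Tn; have {}Tn := Tn isT.
have [tau [tauE TM]] := transfer_structure piI N0 h h' Tn mTs.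
set M := m s (toC (node p s)) in TM *.
have off : toC (node p s) \notin poles p s by exact: node_notin_poles.
have dM : \det M = 1 := OP_det N0 h off.
have uM : M \in unitmx by rewrite unitmxE dM unitr1.
have ws0 : toC (omega p s) != 0 by rewrite fmorph_eq0 om // ltnW.
have tau0 : tau != 0 by apply: contraNneq ws0 => t0; rewrite -tauE t0 mul0r.
have [_ mE _ _ _] := h.
set e := cvec2 P.[toC (node p s)] Q.[toC (node p s)].
have M00 : M 0 0 = P.[toC (node p s)] by rewrite /M mE // mxE.
have M10 : M 1 0 = Q.[toC (node p s)] by rewrite /M mE // mxE.
pose e2 := cvec2 (M 0 1) (M 1 1).
have ME (x : 'cV[Cx R]_2) : M *m x = x 0 0 *: e + x 1 0 *: e2.
  by apply: colvec2P; rewrite mulmx2E ?M00 ?M10 !mxE /=; ring.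
have Tx (x : 'cV[Cx R]_2) : T s *m (M *m x) = (tau * x 1 0) *: e.
  rewrite mulmxA TM -mulmxA ME !mulmx2E !mxE /= !mul0r !add0r.
  by rewrite scale0r addr0.
have VM (x : 'cV[Cx R]_2) : x = M *m (invmx M *m x) by rewrite mulmxA mulmxV // mul1mx.
have e0 : e != 0.
  apply/eqP => ee; have := OP_wronskian N0 h off.
  have := congr1 (fun x : 'cV[Cx R]_2 => x 0 0) ee; rewrite !mxE /= => ->.
  have := congr1 (fun x : 'cV[Cx R]_2 => x 1 0) ee; rewrite !mxE /= => ->.
  by rewrite !mul0r subrr => /esym/eqP; rewrite oner_eq0.
have kerE (v : 'cV[Cx R]_2) : T s *m v = 0 <-> exists l, v = l *: e.
  split=> [|[l ->]].
    rewrite (VM v) Tx => /eqP; rewrite scaler_eq0 (negbTE e0) orbF mulf_eq0.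
    rewrite (negbTE tau0) /= => /eqP x1; exists ((invmx M *m v) 0 0).
    by rewrite ME x1 scale0r addr0.
  have -> : e = M *m cvec2 1 0 by rewrite ME !mxE /= scale1r scale0r addr0.
  by rewrite -scalemxAr Tx !mxE /= mulr0 scale0r scaler0.
split.
  (* [s >= N >= 1], so [q^-(s-1)] is the point that sigma sends to the last pole of [m s]. *)
  have sE : s = s.-1.+1 by rewrite prednK // (leq_trans N0).
  move: (s.-1) sE => t sE.
  have [|phpt phmt _] := Ph t; first by rewrite sE in sM; exact: ltnW.
  have st : toC (sigma_slope p t) != 0 by rewrite fmorph_eq0; exact: sigma_slope_neq0.
  rewrite (sigma_slopeE qR0 u2E) mulf_eq0 negb_or in st; have /andP[_ st1] := st.
  have ht := h; rewrite {1 2}sE in ht.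
  have ts : (t < s)%N by rewrite sE.
  have [_ _ wn _ _] := h; have [_ abn] := wn t ts.
  have [kk [kk0 polek]] := Amx_simple_pole piI N0 q0 sigE ht phpt phmt st1.
  rewrite -sE in polek; eexists; first exact: polek.
  move=> x; split.
    (* The residue is [kk] times the column [e] times the row [(Q, -P)] at node [t]; whichever entry
       of the row is nonzero provides the preimage. *)
    move=> /kerE[l ->]; case: abn => n0.
      exists (cvec2 0 (- (l / (kk * P.[toC (node p t)])))).
      by apply: colvec2P; rewrite !mulmx2E !mxE /=; field; rewrite kk0 n0.
    exists (cvec2 (l / (kk * Q.[toC (node p t)])) 0).
    by apply: colvec2P; rewrite !mulmx2E !mxE /=; field; rewrite kk0 n0.
  move=> [y ->]; apply/kerE.
  exists (kk * (Q.[toC (node p t)] * y 0 0 - P.[toC (node p t)] * y 1 0)).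
  by apply: colvec2P; rewrite !mulmx2E !mxE /=; ring.
move=> v v2 v0 Tv Tv2.
have [k vE] := (kerE v).1 Tv.
set y := invmx M *m v2.
have k0 : k != 0 by apply: contraNneq v0 => k0; rewrite vE k0 scale0r.
(* Only the second coordinate of [v2] in the columns of [M] is determined by [v]; the first adds a
   multiple of [v] and drops out of the determinants. *)
have yE : tau * y 1 0 = k.
  have := Tv2; rewrite (VM v2) Tx -/y vE => /eqP.
  by rewrite -subr_eq0 -scalerBl scaler_eq0 (negbTE e0) orbF subr_eq0 => /eqP.
have dv : det2 v v2 = k ^+ 2 / tau.
  have Me : e = M *m cvec2 1 0 by rewrite ME !mxE /= scale1r scale0r addr0.
  have y1 : y 1 0 = k / tau by rewrite -yE mulrAC divff // mul1r.
  rewrite vE (VM v2) Me -/y -[M *m y]scale1r det2Z det2_mul dM.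
  by rewrite det2E y1 ![cvec2 _ _ _ _]mxE /=; field.
have [php phm phE] := Ph s sM.
have D := det2_derivative piI N0 q0 sigE h h' mTs php phm.
set z0 := toC (rq p) ^- s in php phm phE D *.
set ph := Phi_plus p z0 / Phi_minus p z0.
have ph0 : ph != 0 by rewrite mulf_neq0 // invr_eq0.
set RA := Rmx p s (T s) (toC (rq p) ^- s.+1) *m Amx p (m s) z0.
have off' : toC (node p s.+1) \notin poles p s.+1 by exact: node_notin_poles.
have RAE : RA = m s.+1 (toC (node p s.+1)) *m mx2 ph 0 0 1 *m invmx M.
  by rewrite /RA /Amx /Rmx qV_expr !sigE mTs // !mulmxA.
have dRA : \det RA = ph.
  rewrite RAE !det_mulmx (OP_det N0 h' off') det_mx2 det_inv dM invr1; ring.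
set e' := cvec2 P'.[toC (node p s.+1)] Q'.[toC (node p s.+1)].
have [_ mE' _ _ _] := h'.
have vhE : v_hat p s (m s) (T s) v = (k * ph) *: e'.
  have Me : e = M *m cvec2 1 0 by rewrite ME !mxE /= scale1r scale0r addr0.
  have RAe : RA *m e = ph *: e'.
    rewrite RAE Me mulmxA mulmxKV // -mulmxA.
    by apply: colvec2P; rewrite !mulmx2E mE' // !mxE /=; ring.
  by rewrite /v_hat -/z0 -/RA vE -scalemxAr RAe scalerA.
(* Both vectors are images under [RA], whose determinant [ph] factors out; the rest is linear in the
   derivative term and in [v2]. *)
have dvh : det2 (v_hat p s (m s) (T s) v) (v2_hat p s (m s) (T s) v v2) =
  (toC (sigma_slope p s.+1))^-1 * ph * (z0 * (k * (k * ph) *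
    ((1 - toC (ru p) ^+ 2 / (toC (rq p) * z0 * z0)) * kappa P Q (toC (node p s)) / ph
  - (toC (rq p))^-1 * (1 - toC (ru p) ^+ 2 * toC (rq p) / (z0 * z0)) * kappa P' Q' (toC (node p s.+1))))
  + toC (sigma_slope p s) * (k ^+ 2 / tau)).
  have sS : s = s.-1.+1 by rewrite prednK // (leq_trans N0).
  have slE : toC (rq p) ^- s - toC (ru p) ^+ 2 * toC (rq p) ^+ s.-1 = toC (sigma_slope p s).
    by rewrite [in RHS]sS (sigma_slopeS u2E) -sS.
  rewrite /v2_hat slE -(sigma_slopeS u2E) -/z0 -/RA.
  have -> : v_hat p s (m s) (T s) v = RA *m v by [].
  move: D; set DD := derive _ _ _ => D.
  have DV : det2 v (DD *m (RA *m v)) = k * (k * ph) *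
    ((1 - toC (ru p) ^+ 2 / (toC (rq p) * z0 * z0)) * kappa P Q (toC (node p s)) / ph
    - (toC (rq p))^-1 * (1 - toC (ru p) ^+ 2 * toC (rq p) / (z0 * z0)) * kappa P' Q' (toC (node p s.+1))).
    have -> : RA *m v = (k * ph) *: e' by rewrite -vhE.
    by rewrite vE -scalemxAr det2Z D.
  rewrite -{1}[RA *m v]scale1r det2Z mul1r det2_mul dRA det2_linear_r dv DV.
  exact: mulrA.
have ws1 : toC (omega p s.+1) != 0 by rewrite fmorph_eq0 om.
have sl0 : toC (sigma_slope p s) != 0 by rewrite fmorph_eq0; exact: sigma_slope_neq0.
have sl1 : toC (sigma_slope p s.+1) != 0 by rewrite fmorph_eq0; exact: sigma_slope_neq0.
have eS := sigma_slopeE qR0 u2E s; have eS1 := sigma_slopeS_scaled qR0 u2E s.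
rewrite -/z0 in eS eS1.
have g0 := gap_prob_neq0 piI N0 h hM (leqW (ltnW sM)).
have g1 := gap_prob_step piI N0 h (ltnW sM).
have g2 := gap_prob_step piI N0 h' sM.
have n1 : 1 - toC (omega p s) * kappa P Q (toC (node p s)) != 0.
  by apply: contraNneq ws0 => n0; rewrite -tauE n0 mulr0.
have -> : toC (omega p s.+1 / omega p s) = toC (omega p s.+1) / toC (omega p s).
  by rewrite [LHS]fmorph_div.
rewrite [LHS]fmorph_div rmorphM rmorphXn [LHS]/= g2 g1 dvh dv.
move: tauE phE n1 eS eS1; rewrite -/ph.
move: (kappa P Q _) (kappa P' Q' _) => k1 k2.
move: (toC (gap_prob p s)) g0 (toC (omega p s)) ws0 (toC (omega p s.+1)) ws1 => g g0 w w0 w' ws1.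
move: (toC (sigma_slope p s)) sl0 (toC (sigma_slope p s.+1)) sl1 => a an0 a' an0'.
move=> tauE phE n1 eS eS1.
have pE : Phi_minus p z0 / Phi_plus p z0 = ph^-1 by rewrite /ph invf_div.
have phE' : w' * a = w * ph * a'.
  by apply: (mulfI phm); rewrite mulrA [_ * w']mulrC phE /ph; field.
(* The factor [q^-s] in the definition of [v2_hat] turns the two derivatives of sigma into the
   slopes at [s] and [s.+1]. *)
have -> : z0 * (k * (k * ph) * ((1 - toC (ru p) ^+ 2 / (toC (rq p) * z0 * z0)) * k1 / ph -
      (toC (rq p))^-1 * (1 - toC (ru p) ^+ 2 * toC (rq p) / (z0 * z0)) * k2)) =
    k * (k * ph) * (a * k1 / ph - a' * k2).
  by rewrite eS eS1; ring.
have tE : tau = w / (1 - w * k1) by apply: (mulIf n1); rewrite divfK.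
have wE : w' = w * ph * a' / a by apply: (mulIf an0); rewrite divfK.
(* Both sides now reduce to [(1 - w' k2) / (1 - w k1)], with [w'] and [tau] eliminated. *)
rewrite pE tE wE.
clear -g0 w0 k0 ph0 an0 an0' n1; move: ph0; move: ph => f f0.
by field; rewrite ?g0 ?w0 ?k0 ?f0 ?an0 ?an0' ?n1.
Qed.
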